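(* Let $\Gamma$ be an abstract group, let $F$ be a non-archimedean local field of characteristic zero, and let $\rho_1,\rho_2:\Gamma\to GL_n(F)$ be semisimple representations. Then the following are equivalent: (1) $\rho_1$ and $\rho_2$ are potentially equivalent; (2) $\rho_1$ and $\rho_2$ are elementwise potentially equivalent; (3) there exists a natural number $m$ depending only on $n$ and $F$ such that $\chi^{[m]}_{\rho_1}=\chi^{[m]}_{\rho_2}$, i.e. $\mathrm{Tr}(\rho_1(g^m))=\mathrm{Tr}(\rho_2(g^m))$ for all $g\in\Gamma$.
   Context: Two representations of a group are potentially equivalent if their restrictions to some subgroup of finite index are isomorphic. Two representations $\rho_1,\rho_2:\Gamma\to GL_n(F)$ are elementwise potentially equivalent if for every $g\in\Gamma$ there is a natural number $m_g\geq 1$ such that $\rho_1(g)^{m_g}$ and $\rho_2(g)^{m_g}$ are conjugate in $GL_n(F)$. The $m$-power character of $\rho$ is $\chi^{[m]}_\rho(g)=\mathrm{Tr}(\rho(g^m))$. *)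

(* Defs.v *)
From HB Require Import structures.
From mathcomp Require Import all_boot all_order all_algebra.

Set Implicit Arguments.
Unset Strict Implicit.
Unset Printing Implicit Defensive.

Import Order.TTheory GRing.Theory Num.Theory.
Local Open Scope ring_scope.

Section LocalFields.
Variable F : fieldType.
Implicit Types (v : F -> int) (x y l : F) (u : nat -> F).

(* The value [v 0] is irrelevant: every clause below is guarded, which amounts
   to the usual convention v(0) = +oo. *)
Definition val_ge v (k : int) x : bool := (x == 0) || (k <= v x).

(* Normalised: the last clause makes v surjective onto int. *)
Definition discrete_valuation v : Prop :=
  [/\ forall x y, x != 0 -> y != 0 -> v (x * y) = v x + v y,
      forall k x y, val_ge v k x -> val_ge v k y -> val_ge v k (x + y)
    & exists2 x, x != 0 & v x = 1].

Definition val_cauchy v u : Prop :=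
  forall k : int, exists N : nat, forall i j : nat,
    (N <= i)%N -> (N <= j)%N -> val_ge v k (u i - u j).

Definition val_converges v u l : Prop :=
  forall k : int, exists N : nat, forall i : nat,
    (N <= i)%N -> val_ge v k (u i - l).

Definition val_complete v : Prop :=
  forall u, val_cauchy v u -> exists l, val_converges v u l.

(* The ring {v >= 0} is covered by finitely many cosets of its maximal ideal
   {v >= 1}. *)
Definition finite_residue_field v : Prop :=
  exists s : seq F, forall x, val_ge v 0 x ->
    exists2 a, a \in s & val_ge v 1 (x - a).

Definition nonarch_local_field : Prop :=
  exists v : F -> int,
    [/\ discrete_valuation v, val_complete v & finite_residue_field v].

End LocalFields.

(* MathComp's [groupType] is not restricted to finite groups. *)
Record gl_repr (F : fieldType) (G : groupType) (n : nat) := GLRepr {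
  gl_repr_mx :> G -> 'M[F]_n;
  gl_repr_unit : forall g, gl_repr_mx g \in unitmx;
  gl_reprM : {morph gl_repr_mx : g h / (g * h)%g >-> g *m h}
}.

Section Representations.
Variables (F : fieldType) (G : groupType) (n : nat).
Implicit Types (rho : gl_repr F G n) (U V : 'M[F]_n) (H : {pred G}).

(* As in MathComp's [mxrepresentation], which only covers finite groups, a
   subspace is the row space of a square matrix and g acts on row vectors by
   u |-> u *m rho g. *)
Definition invariant_subspace rho U : Prop := forall g, stablemx U (rho g).

Definition irreducible_subspace rho U : Prop :=
  [/\ invariant_subspace rho U, U != 0
    & forall V, invariant_subspace rho V -> (V <= U)%MS -> V != 0 ->
        (U <= V)%MS].

Definition semisimple_repr rho : Prop :=
  exists (k : nat) (U : 'I_k -> 'M[F]_n),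
    [/\ forall i, irreducible_subspace rho (U i),
        (\sum_i U i :=: 1%:M)%MS
      & mxdirect (\sum_i U i)%MS].

Definition finite_index_subgroup H : Prop :=
  group_closed H /\
  exists s : seq G, forall g, exists2 a, a \in s & (a^-1 * g)%g \in H.

Definition isomorphic_on H rho1 rho2 : Prop :=
  exists2 B : 'M[F]_n, B \in unitmx
    & {in H, forall h, B *m rho1 h = rho2 h *m B}.

Definition potentially_equivalent rho1 rho2 : Prop :=
  exists2 H : {pred G}, finite_index_subgroup H & isomorphic_on H rho1 rho2.

Definition gl_conjugate (A B : 'M[F]_n) : Prop :=
  exists2 P : 'M[F]_n, P \in unitmx & B = P *m A *m invmx P.

Definition elementwise_potentially_equivalent rho1 rho2 : Prop :=
  forall g, exists2 m : nat, (1 <= m)%N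
    & gl_conjugate (rho1 g ^+ m) (rho2 g ^+ m).

Definition power_character (m : nat) rho (g : G) : F := \tr (rho (g ^+ m)%g).

End Representations.

(* Main.v *)
Require Import Defs.
From HB Require Import structures.
From mathcomp Require Import all_boot all_order all_algebra.
From mathcomp Require Import fieldext boolp zify ring lra.

Set Implicit Arguments.
Unset Strict Implicit.
Unset Printing Implicit Defensive.

Import Order.TTheory GRing.Theory Num.Theory.
Local Open Scope ring_scope.

(** (1) => (2): some positive power of each element lies in the subgroup.

    (2) => (3): if A ^+ k and B ^+ k are conjugate, the eigenvalues of A and B
    match up to roots of unity x / y, each a root of a monic polynomial of
    degree n^2 over F, namely the characteristic polynomial of the operator
    M |-> A *m M *m B^-1.  A root of unity of degree at most d over F is an
    eigenvalue of an integral matrix C of finite order and of size at most d.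
    Two among boundedly many powers of C agree modulo a fixed power of the
    maximal ideal, and for a high enough power the congruence subgroup is
    torsion free.  This bounds the order of C in terms of d and F only.

    (3) => (1): the operator M |-> \sum_k A ^+ k *m M *m B ^+ (m - 1 - k) with
    A = rho1 g, B = rho2 g has a determinant that does not vanish at g = 1, and
    where it does not vanish the eigenvalues of A and B coincide.  So
    (\tr rho1 - \tr rho2) * det = 0 on G, and \tr rho1 = \tr rho2 on the
    identity component of the Zariski topology.  Functions g |-> phi g *m c, for
    a fixed phi whose translates depend linearly on phi, are enough here: the
    resulting topology is noetherian for dimension reasons, without the Hilbert
    basis theorem.  The component is normal of finite index, so by Clifford the
    restrictions are semisimple, and in characteristic 0 semisimple
    representations are determined by their traces. *)

(** * Eigenvalues of powers of a matrix *)

Lemma irreducible_factor (F : fieldType) (p : {poly F}) : (1 < size p)%N ->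
  exists2 q : {poly F}, irreducible_poly q & q %| p.
Proof.
have [k] := ubnP (size p); elim: k p => // k IHk p lt_pk gt1p.
have [irr_p | not_irr] := pselect (irreducible_poly p); first by exists p.
have [q [sq1 dvd_qp neq_qp]] :
    exists q : {poly F}, [/\ size q != 1, q %| p & ~ (q %= p)].
  apply: contrapT => noq; apply: not_irr; split=> // q sq1 dvd_qp.
  by apply: contrapT => neq_qp; apply: noq; exists q.
have p0 : p != 0 by rewrite -size_poly_gt0 ltnW.
have q0 : q != 0 by apply: contraNneq p0 => q0; rewrite q0 dvd0p in dvd_qp.
have gt1q : (1 < size q)%N.
  by rewrite ltn_neqAle eq_sym sq1 size_poly_gt0.
have lt_qp : (size q < size p)%N.
  rewrite ltn_neqAle dvdp_leq // andbT.
  by apply/negP => sqp; apply: neq_qp; rewrite -dvdp_size_eqp.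
have [r irr_r dvd_rq] := IHk q (leq_trans lt_qp lt_pk) gt1q.
by exists r => //; apply: dvdp_trans dvd_rq dvd_qp.
Qed.

(** Adjoin a root of an irreducible factor, then split the cofactor over the larger field; induction
    on the degree. *)
Lemma splitting_field (F : fieldType) (p : {poly F}) : p \is monic ->
  exists (E : fieldType) (iota : {rmorphism F -> E}) (s : seq E),
    map_poly iota p = \prod_(x <- s) ('X - x%:P).
Proof.
have [k] := ubnP (size p); elim: k F p => // k IHk F p lt_pk mon_p.
have [le1p | gt1p] := leqP (size p) 1.
  exists F, idfun, [::]; rewrite big_nil map_poly_id //.
  by move: mon_p; rewrite (size1_polyC le1p) monicE lead_coefC => /eqP->.
have [q irr_q dvd_qp] := irreducible_factor gt1p.
have [L _ [z rz _]] := irredp_FAdjoin irr_q.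
have mon_pL : map_poly (in_alg L) p \is monic by rewrite map_monic.
have : root (map_poly (in_alg L) p) z.
  by apply: root_dvdp rz; rewrite dvdp_map.
case/factor_theorem=> r def_r.
have mon_r : r \is monic.
  by move: mon_pL; rewrite def_r monicMr ?monicXsubC.
have r0 := monic_neq0 mon_r.
have szp : size p = (size r).+1.
  by rewrite -(size_map_poly (in_alg L)) def_r size_Mmonic ?monicXsubC //
    size_XsubC addn2.
have [|E [iota [s def_s]]] := IHk L r _ mon_r; first by rewrite szp in lt_pk.
exists E, (iota \o in_alg L), (iota z :: s).
rewrite map_poly_comp def_r rmorphM /= def_s big_cons mulrC rmorphB /=.
by rewrite map_polyX map_polyC.
Qed.

(** On both lists [g] factors through [f]. The hypothesis compares only members of [s] with members
    of [t], so two members of [s] with the same image are compared through a member of [t]. This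
    serves to pass from one power of the eigenvalues to another. *)
Lemma perm_eq_map_trans (T U V : eqType) (f : T -> U) (g : T -> V)
    (s t : seq T) :
  {in s & t, forall x y, f x = f y -> g x = g y} ->
  perm_eq (map f s) (map f t) -> perm_eq (map g s) (map g t).
Proof.
case: s => [|x0 s0] fg eq_f; first by move: (perm_size eq_f); case: t {fg eq_f}.
set s := x0 :: s0 in fg eq_f *; have memE := perm_mem eq_f.
pose h y := g (nth x0 s (find (fun x => f x == y) s)).
have findP z : f z \in map f s ->
    exists2 x, x \in s & f x = f z /\ h (f z) = g x.
  case/mapP=> x xs fzx.
  have hasz : has (fun x => f x == f z) s by apply/hasP; exists x; rewrite ?fzx.
  exists (nth x0 s (find (fun x => f x == f z) s));
    first by rewrite mem_nth -?has_find.
  by split=> //; apply/eqP/(nth_find x0 hasz).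
have ht : {in t, forall y, h (f y) = g y}.
  move=> y yt; have [|x xs [fxy ->]] := findP y; first by rewrite memE map_f.
  exact: fg.
have hs : {in s, forall x, h (f x) = g x}.
  move=> x xs; have : f x \in map f t by rewrite -memE map_f.
  by case/mapP=> y yt fxy; rewrite fxy ht // (fg x y).
have -> : map g s = map h (map f s).
  by rewrite -map_comp; apply/eq_in_map => x /hs.
have -> : map g t = map h (map f t).
  by rewrite -map_comp; apply/eq_in_map => x /ht.
exact: perm_map.
Qed.

Lemma natr_inj_char0 (F : fieldType) :
  [pchar F] =i pred0 -> injective (fun k : nat => k%:R : F).
Proof.
move=> /pcharf0P nat0 i j /eqP.
wlog le_ij : i j / (i <= j)%N.
  by move=> IH; have [/IH //|/ltnW/IH + eq_ij] := leqP i j;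
    rewrite eq_sym => /(_ eq_ij).
by rewrite eq_sym -subr_eq0 -natrB // nat0 subn_eq0 => le_ji; apply/eqP;
  rewrite eqn_leq le_ij.
Qed.

Lemma splitting_field2 (F : fieldType) (p q : {poly F}) :
  p \is monic -> q \is monic ->
  exists (E : fieldType) (iota : {rmorphism F -> E}) (s t : seq E),
    map_poly iota p = \prod_(x <- s) ('X - x%:P) /\
    map_poly iota q = \prod_(x <- t) ('X - x%:P).
Proof.
move=> mon_p mon_q; have [L [i [s def_p]]] := splitting_field mon_p.
have mon_q' : map_poly i q \is monic by rewrite map_monic.
have [E [j [t def_q]]] := splitting_field mon_q'.
exists E, (j \o i), (map j s), t; rewrite !map_poly_comp def_p def_q;
  split=> //.
rewrite rmorph_prod big_map; apply: eq_bigr => x _.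
by rewrite rmorphB /= map_polyX map_polyC.
Qed.

Section CharPoly.
Variable F : fieldType.

Lemma char_poly_conj n (Q A : 'M[F]_n) :
  Q \in unitmx -> char_poly (Q *m A *m invmx Q) = char_poly A.
Proof.
move=> uQ; rewrite /char_poly.
have -> : char_poly_mx (Q *m A *m invmx Q) =
    map_mx polyC Q *m char_poly_mx A *m map_mx polyC (invmx Q).
  rewrite /char_poly_mx !map_mxM /= mulmxBr mulmxBl; congr (_ - _).
  by rewrite scalar_mxC -mulmxA -map_mxM mulmxV // map_mx1 mulmx1.
rewrite !det_mulmx mulrAC -det_mulmx -map_mxM mulmxV // map_mx1 det1 mul1r //.
Qed.

Lemma char_poly_lblock n1 n2 (A : 'M[F]_n1)
    (C : 'M[F]_(n2, n1)) (D : 'M[F]_n2) :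
  char_poly (block_mx A 0 C D) = char_poly A * char_poly D.
Proof.
rewrite /char_poly /char_poly_mx map_block_mx map_mx0 scalar_mx_block.
by rewrite opp_block_mx add_block_mx subr0 det_lblock.
Qed.

Lemma expr_lblock n1 n2 (A : 'M[F]_n1) (C : 'M[F]_(n2, n1)) (D : 'M[F]_n2) k :
  exists C', (block_mx A 0 C D : 'M_(n1 + n2)) ^+ k =
    block_mx (A ^+ k) 0 C' (D ^+ k).
Proof.
elim: k => [|k [C' IHk]]; first by exists 0; rewrite !expr0 -scalar_mx_block.
exists (C *m A ^+ k + D *m C').
by rewrite !exprS IHk -!mulmxE mulmx_block !mulmx0 !mul0mx !addr0 add0r.
Qed.

Lemma expr_conjmx n (Q A : 'M[F]_n) k : Q \in unitmx ->
  (Q *m A *m invmx Q) ^+ k = Q *m A ^+ k *m invmx Q.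
Proof.
move=> uQ; elim: k => [|k IHk]; first by rewrite !expr0 mulmx1 mulmxV.
by rewrite !exprS IHk -!mulmxE !mulmxA mulmxKV.
Qed.

(** Complete an eigenvector to a basis. Eigenvectors are rows, so it is the upper right block that
    vanishes. *)
Lemma lblock_eigenvalue n (A : 'M[F]_(1 + n)) x : eigenvalue A x ->
  exists (Q : 'M_(1 + n)) (C : 'M_(n, 1)) (D : 'M_n),
    Q \in unitmx /\ Q *m A *m invmx Q = block_mx x%:M 0 C D.
Proof.
case/eigenvalueP=> v vA v0; pose Q := row_ebase v.
have uQ : Q \in unitmx by apply: row_ebase_unit.
pose r : 'rV_(1 + n) := usubmx Q.
have rk_v : \rank v = 1%N by rewrite rank_rV v0.
(* As [v] has rank one, it is a nonzero multiple of the first row of [row_ebase v], which is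
   therefore an eigenvector too. *)
have def_v : v = col_ebase v *m r.
  rewrite -[LHS]mulmx_ebase rk_v -mulmxA; congr (_ *m _).
  rewrite -[row_ebase v]vsubmxK.
  rewrite [pid_mx 1](_ : _ = row_mx 1%:M 0) ?mul_row_col ?mul1mx ?mul0mx ?addr0
    //.
  exact: pid_mx_row.
have rA : r *m A = x *: r.
  apply: (can_inj (mulKmx (col_ebase_unit v))).
  by rewrite mulmxA -def_v vA -scalemxAr -def_v.
pose T := Q *m A *m invmx Q.
exists Q, (dlsubmx T), (drsubmx T); split=> //.
have uT : usubmx T = row_mx x%:M 0.
  rewrite /T -!mul_usub_mx rA -scalemxAl mul_usub_mx mulmxV //.
  by rewrite scalar_mx_block block_mxEv col_mxKu -mul_scalar_mx mul_mx_row
    mulmx1 mulmx0.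
by rewrite -[LHS]submxK /ulsubmx /ursubmx uT row_mxKl row_mxKr.
Qed.

(** Triangularisation: split off one eigenvalue in block form and induct on the size. *)
Lemma char_poly_exp n (A : 'M[F]_n) (s : seq F) k :
  char_poly A = \prod_(x <- s) ('X - x%:P) ->
  char_poly (A ^+ k) = \prod_(x <- s) ('X - (x ^+ k)%:P).
Proof.
elim: n A s => [|n IHn] A s pA.
  have: size s = 0 by apply/succn_inj;
    rewrite -(size_prod_XsubC s id) -pA size_char_poly.
  by case: s {pA} => // _; rewrite big_nil /char_poly det_mx00.
have: size s = n.+1 by apply/succn_inj;
  rewrite -(size_prod_XsubC s id) -pA size_char_poly.
case: s pA => // x s pA _.
have : eigenvalue A x.
  by rewrite eigenvalue_root_char pA root_prod_XsubC mem_head.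
case/(@lblock_eigenvalue n) => Q [C [D [uQ def_QA]]].
have: char_poly D = \prod_(y <- s) ('X - y%:P).
  have/mulfI : 'X - x%:P != 0 by rewrite polyXsubC_eq0.
  apply; move: pA; rewrite big_cons => <-;
    rewrite -(char_poly_conj A uQ) def_QA.
  apply/esym; apply: etrans (char_poly_lblock x%:M C D) _.
  by rewrite /char_poly det_mx11 !mxE eqxx !mulr1n.
move/IHn => pDk; have [C' def_k] := expr_lblock x%:M C D k.
rewrite -(char_poly_conj _ uQ) -expr_conjmx // def_QA def_k.
apply: etrans (char_poly_lblock (x%:M ^+ k) C' (D ^+ k)) _;
  rewrite pDk big_cons; congr (_ * _).
rewrite -rmorphXn.
by rewrite /char_poly det_mx11 !mxE eqxx !mulr1n.
Qed.

Lemma trace_char_poly n (A B : 'M[F]_n) :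
  char_poly A = char_poly B -> \tr A = \tr B.
Proof.
case: n A B => [|n] A B eqAB; first by rewrite /mxtrace !big_ord0.
by apply: oppr_inj; rewrite -!char_poly_trace // eqAB.
Qed.

Lemma trace_exp_roots n (A : 'M[F]_n) (s : seq F) k :
  char_poly A = \prod_(x <- s) ('X - x%:P) ->
    \tr (A ^+ k) = \sum_(x <- s) x ^+ k.
Proof.
move=> pA; case: n A pA => [|n] A pA.
  have: size s = 0 by apply/succn_inj;
    rewrite -(size_prod_XsubC s id) -pA size_char_poly.
  by case: s {pA} => // _; rewrite big_nil /mxtrace big_ord0.
have sz : size s = n.+1 by apply/succn_inj;
  rewrite -(size_prod_XsubC s id) -pA size_char_poly.
apply: oppr_inj; rewrite -char_poly_trace // (char_poly_exp k pA).
by rewrite -(big_map (fun x => x ^+ k) xpredT (fun x =>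
  'X - x%:P)) -sz -(size_map (fun x =>
    x ^+ k)) coefPn_prod_XsubC ?big_map // size_map sz.
Qed.

(** Equal power sums give equal sums of values of any polynomial. One that vanishes at all the
    points except [x] isolates the multiplicity of [x], which can be read in [F] because the
    characteristic is 0. *)
Lemma eq_power_sums (s t : seq F) : [pchar F] =i pred0 ->
  (forall k, \sum_(x <- s) x ^+ k = \sum_(x <- t) x ^+ k) -> perm_eq s t.
Proof.
move=> char0 eq_st.
have eq_poly (p : {poly F}) : \sum_(x <- s) p.[x] = \sum_(x <- t) p.[x].
  under eq_bigr do rewrite horner_coef;
    under [RHS]eq_bigr do rewrite horner_coef.
  rewrite exchange_big [RHS]exchange_big /=; apply: eq_bigr => i _.
  by rewrite -!mulr_sumr eq_st.
apply/allP => x _ /=; set r := [seq y <- undup (s ++ t) | y != x].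
pose p := \prod_(y <- r) ('X - y%:P).
have sum_p u : {subset u <= s ++ t} ->
    \sum_(y <- u) p.[y] = p.[x] *+ count_mem x u.
  move=> sub_u; rewrite (bigID (pred1 x)) /= [X in _ + X]big1_seq ?addr0;
    last first.
    move=> y /andP[yx /sub_u yst]; apply/rootP.
    by rewrite root_prod_XsubC mem_filter yx mem_undup.
  rewrite (eq_bigr (fun=> p.[x])) => [|y /eqP -> //].
  by rewrite big_const_seq iter_addr_0.
have px0 : p.[x] != 0.
  by rewrite -[_ == 0]/(root p x) root_prod_XsubC mem_filter eqxx.
have := eq_poly p; rewrite !sum_p; first last.
- by move=> y ys; rewrite mem_cat ys.
- by move=> y yt; rewrite mem_cat yt orbT.
move=> /eqP; rewrite -[X in X == _]mulr_natr -[X in _ == X]mulr_natr.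
rewrite (inj_eq (mulfI px0)) => /eqP eq_n.
exact/eqP/(natr_inj_char0 char0).
Qed.

End CharPoly.

Section Traces.
Variable F : fieldType.

Lemma eq_char_poly_traces n (A B : 'M[F]_n) : [pchar F] =i pred0 ->
  (forall k, \tr (A ^+ k.+1) = \tr (B ^+ k.+1)) -> char_poly A = char_poly B.
Proof.
move=> char0 eq_tr.
have [E [i [s [t [pA pB]]]]] :=
  splitting_field2 (char_poly_monic A) (char_poly_monic B).
apply: (map_poly_inj i); rewrite pA pB; apply: perm_big.
apply: eq_power_sums => [x|k]; first by rewrite (fmorph_pchar i) char0.
rewrite (map_char_poly i) in pA; rewrite (map_char_poly i) in pB.
rewrite -(trace_exp_roots k pA) -(trace_exp_roots k pB) -!rmorphXn
  !trace_map_mx.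
(* The exponent 0 gives the trace of the identity on both sides. *)
by case: k => [|k]; rewrite ?expr0 ?eq_tr.
Qed.

(** The traces agree with those of the zero matrix, so the characteristic polynomial is ['X^n] and
    Cayley-Hamilton concludes. *)
Lemma nilpotent_traces n (A : 'M[F]_n) : [pchar F] =i pred0 ->
  (forall k, \tr (A ^+ k.+1) = 0) -> A ^+ n = 0.
Proof.
move=> char0 tr0; case: n A tr0 => [|n] A tr0;
  first by rewrite [LHS]flatmx0 [RHS]flatmx0.
have pA : char_poly A = 'X^(n.+1).
  rewrite (@eq_char_poly_traces _ A 0) // => [|k].
    by rewrite char_poly_trig ?mx0_is_trig // (eq_bigr (fun=> 'X)) => [|j _];
      rewrite ?prodr_const ?card_ord // mxE subr0.
  by rewrite tr0 expr0n mxtrace0.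
by have := Cayley_Hamilton A; rewrite pA rmorphXn /= horner_mx_X.
Qed.

End Traces.

(** * Two-sided multiplication operators *)

(** Multiply a column eigenvector of [A] by a row eigenvector of [B]. *)
Lemma eigen_matrix (E : fieldType) n (A B : 'M[E]_n) x y :
    root (char_poly A) x -> root (char_poly B) y ->
  exists2 M : 'M[E]_n, M != 0 & A *m M = x *: M /\ M *m B = y *: M.
Proof.
have char_tr : char_poly A^T = char_poly A.
  rewrite /char_poly -[RHS]det_tr; congr (\det _).
  by rewrite /char_poly_mx linearB /= tr_scalar_mx map_trmx.
rewrite -char_tr -!eigenvalue_root_char.
case/eigenvalueP=> u uA u0 /eigenvalueP[w wB w0].
exists (u^T *m w); last first.
  split; last by rewrite -mulmxA wB scalemxAr.
  by rewrite mulmxA -[A]trmxK -trmx_mul uA linearZ /= scalemxAl.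
rewrite mulmx_free_eq0; last by rewrite /row_free rank_rV w0.
by rewrite trmx_eq0.
Qed.

Section TwoSided.
Variables (F : fieldType) (n : nat).
Implicit Types A B : 'M[F]_n.

Lemma map_two_sided (E : fieldType) (i : {rmorphism F -> E}) A B :
  map_mx i (lin_mulmx A *m lin_mulmxr B) =
  lin_mulmx (map_mx i A) *m lin_mulmxr (map_mx i B) :> 'M_(n * n).
Proof.
by rewrite map_mxM; congr (_ *m _); apply: map_lin_mx => M /=; rewrite map_mxM.
Qed.

Lemma mxvec_two_sided A B M :
  mxvec M *m (lin_mulmx A *m lin_mulmxr B) = mxvec (A *m M *m B).
Proof. by rewrite mulmxA !mul_vec_lin. Qed.

(* The determinant is the product of the [\sum_k x ^+ k * y ^+ (m - 1 - k)]
   over all pairs of an eigenvalue x of A and an eigenvalue y of B, so it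
   vanishes iff x ^+ m = y ^+ m for some such x and y that do not agree
   (or for some x = y with m x ^+ m.-1 = 0). *)
Definition cyclo_mx m A B : 'M[F]_(n * n) :=
  \sum_(k < m) lin_mulmx (A ^+ k) *m lin_mulmxr (B ^+ (m.-1 - k)).

End TwoSided.

Lemma map_cyclo_mx (F E : fieldType) (i : {rmorphism F -> E}) n m
    (A B : 'M[F]_n) :
  map_mx i (cyclo_mx m A B) = cyclo_mx m (map_mx i A) (map_mx i B).
Proof.
rewrite raddf_sum; apply: eq_bigr => k _.
by rewrite /= map_two_sided -!rmorphXn.
Qed.

(** The matrix given by [eigen_matrix] is an eigenvector of [M |-> A *m M *m invmx B] for [x / y].
    This operator is defined over [F], so one [P] serves all extensions. *)
Lemma ratio_root (F : fieldType) n (A B : 'M[F]_n) : B \in unitmx ->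
  exists2 P : {poly F}, P \is monic /\ size P = (n * n).+1 &
    forall (E : fieldType) (i : {rmorphism F -> E}) x y,
      root (char_poly (map_mx i A)) x -> root (char_poly (map_mx i B)) y ->
      y != 0 /\ root (map_poly i P) (x / y).
Proof.
move=> uB; pose L := lin_mulmx A *m lin_mulmxr (invmx B) : 'M_(n * n).
exists (char_poly L); first by rewrite char_poly_monic size_char_poly.
move=> E i x y rx ry; have [M M0 [AM MB]] := eigen_matrix rx ry.
have uBi : map_mx i B \in unitmx by rewrite map_unitmx.
have y0 : y != 0.
  apply: contraNneq M0 => y0; move: MB; rewrite y0 scale0r => MB.
  by rewrite -[M](mulmxK uBi) MB mul0mx.
split=> //; rewrite map_char_poly -eigenvalue_root_char.
apply/eigenvalueP; exists (mxvec M);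
  last by rewrite -[X in _ != X](linear0 mxvec) (inj_eq (can_inj mxvecK)).
rewrite map_two_sided mxvec_two_sided AM map_invmx -scalemxAl.
have -> : M *m invmx (map_mx i B) = y^-1 *: M.
  by apply: (can_inj (mulmxK uBi));
    rewrite mulmxKV // -scalemxAl MB scalerA mulVf ?scale1r.
by rewrite scalerA linearZ.
Qed.

(** A common exponent for the roots of unity of degree at most [d] over [F]. It ranges over all
    extensions because the splitting fields in use vary with the group element. *)
Definition bounded_torsion (F : fieldType) (d m : nat) :=
  forall (E : fieldType) (i : {rmorphism F -> E}) (P : {poly F}) (z : E) N,
    (0 < N)%N -> z ^+ N = 1 -> P \is monic -> (size P <= d.+1)%N ->
    root (map_poly i P) z -> z ^+ m = 1.

(** Eigenvalues with equal [k]-th powers differ by a root of unity of degree at most [n * n], so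
    their [m]-th powers agree too, and the matching of the spectra carries over from [k] to [m]. *)
Lemma trace_exp_potential (F : fieldType) n m k (A B : 'M[F]_n) :
    bounded_torsion F (n * n) m -> (0 < k)%N -> B \in unitmx ->
  char_poly (A ^+ k) = char_poly (B ^+ k) -> \tr (A ^+ m) = \tr (B ^+ m).
Proof.
move=> tors k0 uB eq_k; apply: trace_char_poly.
have [P [monP szP] rootP] := ratio_root A uB.
have [E [i [s [t [pA pB]]]]] :=
  splitting_field2 (char_poly_monic A) (char_poly_monic B).
rewrite (map_char_poly i) in pA; rewrite (map_char_poly i) in pB.
apply: (map_poly_inj i); rewrite !map_char_poly !rmorphXn.
rewrite (char_poly_exp m pA) (char_poly_exp m pB).
have rootA x : (x \in s) = root (char_poly (map_mx i A)) x.
  by rewrite pA root_prod_XsubC.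
have rootB x : (x \in t) = root (char_poly (map_mx i B)) x.
  by rewrite pB root_prod_XsubC.
have perm_k : perm_eq (map (fun x => x ^+ k) s) (map (fun x => x ^+ k) t).
  apply: prod_XsubC_eq;
    rewrite !big_map -(char_poly_exp k pA) -(char_poly_exp k pB).
  by rewrite -!rmorphXn -!map_char_poly eq_k.
have ratio x y : x \in s -> y \in t -> x ^+ k = y ^+ k -> x ^+ m = y ^+ m.
  rewrite rootA rootB => rx ry eq_xy.
  have [y0 rxy] := rootP _ _ _ _ rx ry.
  have xyk : (x / y) ^+ k = 1 by rewrite expr_div_n eq_xy divff // expf_neq0.
  have := tors E i P _ k k0 xyk monP; rewrite szP => /(_ (leqnn _) rxy).
  rewrite expr_div_n => /(congr1 ( *%R^~ (y ^+ m))).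
  by rewrite mul1r divfK // expf_neq0.
rewrite -(big_map (fun x => x ^+ m) xpredT (fun x => 'X - x%:P)).
rewrite -[RHS](big_map (fun x => x ^+ m) xpredT (fun x => 'X - x%:P)).
exact/perm_big/perm_eq_map_trans/perm_k.
Qed.

(** Eigenvalues [x != y] with [x ^+ m = y ^+ m] would put their common eigenmatrix in the kernel of
    [cyclo_mx]. Hence a matching of the [m]-th powers is a matching of the eigenvalues
    themselves. *)
Lemma char_poly_cyclo (F : fieldType) n m (A B : 'M[F]_n) :
    char_poly (A ^+ m) = char_poly (B ^+ m) -> \det (cyclo_mx m A B) != 0 ->
  char_poly A = char_poly B.
Proof.
move=> eq_m; rewrite -unitfE -unitmxE => uL.
have [E [i [s [t [pA pB]]]]] :=
  splitting_field2 (char_poly_monic A) (char_poly_monic B).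
apply: (map_poly_inj i); rewrite pA pB.
rewrite (map_char_poly i) in pA; rewrite (map_char_poly i) in pB.
have perm_m : perm_eq (map (fun x => x ^+ m) s) (map (fun x => x ^+ m) t).
  apply: prod_XsubC_eq;
    rewrite !big_map -(char_poly_exp m pA) -(char_poly_exp m pB).
  by rewrite -!rmorphXn -!map_char_poly eq_m.
apply: perm_big; rewrite -[s]map_id -[t]map_id.
apply: perm_eq_map_trans perm_m => x y xs yt eq_xy.
apply/eqP; rewrite -subr_eq0; apply: contraLR uL => xy0.
have rx : root (char_poly (map_mx i A)) x by rewrite pA root_prod_XsubC.
have ry : root (char_poly (map_mx i B)) y by rewrite pB root_prod_XsubC.
have [M M0 [AM MB]] := eigen_matrix rx ry.
rewrite -(map_unitmx i) map_cyclo_mx; apply: contraNN M0 => uL.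
rewrite -(inj_eq (can_inj mxvecK)) linear0 -(mulmxK uL (mxvec M)).
suff -> : mxvec M *m cyclo_mx m (map_mx i A) (map_mx i B) = 0 by rewrite mul0mx.
have AMk k : map_mx i A ^+ k *m M = x ^+ k *: M.
  elim: k => [|k IHk]; first by rewrite !expr0 mul1mx scale1r.
  by rewrite exprSr -mulmxE -mulmxA AM -scalemxAr IHk scalerA exprS.
have MBk k : M *m map_mx i B ^+ k = y ^+ k *: M.
  elim: k => [|k IHk]; first by rewrite !expr0 mulmx1 scale1r.
  by rewrite exprS -mulmxE mulmxA MB -scalemxAl IHk scalerA exprS.
rewrite mulmx_sumr (eq_bigr (fun k : 'I_m =>
  (y ^+ (m.-1 - k) * x ^+ k) *: mxvec M)); last first.
  by move=> k _; rewrite mxvec_two_sided AMk -scalemxAl MBk scalerA linearZ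
    mulrC.
(* The scalar is the cofactor of [y - x] in [y ^+ m - x ^+ m], which is 0. *)
rewrite -scaler_suml;
  have : (y - x) * (\sum_(k < m) y ^+ (m.-1 - k) * x ^+ k) = 0.
  by rewrite -subrXX eq_xy subrr.
by move/eqP; rewrite mulf_eq0 -[y - x]opprB oppr_eq0 (negPf xy0) => /eqP->;
  rewrite scale0r.
Qed.

(** At the identity of the group the determinant is thus a power of [m], nonzero in characteristic 0
    for positive [m]. *)
Lemma cyclo_mx1 (F : fieldType) n m :
  cyclo_mx m (1%:M : 'M[F]_n) 1%:M = (m%:R)%:M.
Proof.
rewrite /cyclo_mx (eq_bigr (fun=> 1%:M)) ?sumr_const ?card_ord => [|k _].
  by rewrite -[RHS]scalemx1 scaler_nat.
by rewrite !expr1n; apply/row_matrixP => j;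
  rewrite !rowE -[delta_mx 0 j]vec_mxK mxvec_two_sided mulmx1 mul1mx mulmx1.
Qed.

(** * Roots of unity of bounded degree over a local field *)

Section Valuation.
Variables (F : fieldType) (v : F -> int).
Hypothesis valv : discrete_valuation v.
Local Notation ge := (val_ge v).

Lemma valM x y : x != 0 -> y != 0 -> v (x * y) = v x + v y.
Proof. by case: valv => vM _ _; apply: vM. Qed.

Lemma val_geD k x y : ge k x -> ge k y -> ge k (x + y).
Proof. by case: valv => _ vD _; apply: vD. Qed.

Lemma val_ge0 k : ge k 0. Proof. by rewrite /val_ge eqxx. Qed.

Lemma val1 : v 1 = 0.
Proof. by have := valM (oner_neq0 F) (oner_neq0 F); rewrite mulr1; lra. Qed.

Lemma valN x : x != 0 -> v (- x) = v x.
Proof.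
move=> x0; have n10 : (-1 : F) != 0 by rewrite oppr_eq0 oner_neq0.
have := valM n10 n10; rewrite mulrNN mulr1 val1 => vN1.
by rewrite -mulN1r valM //; lia.
Qed.

Lemma val_geN k x : ge k x -> ge k (- x).
Proof. by rewrite /val_ge oppr_eq0; case: eqVneq => //= x0; rewrite valN. Qed.

Lemma val_geB k x y : ge k x -> ge k y -> ge k (x - y).
Proof. by move=> kx /val_geN; apply: val_geD. Qed.

Lemma val_geW k l x : l <= k -> ge k x -> ge l x.
Proof. by rewrite /val_ge => lk; case: eqP => //= _; apply: le_trans. Qed.

Lemma val_geM k l x y : ge k x -> ge l y -> ge (k + l) (x * y).
Proof.
rewrite /val_ge mulf_eq0; case: eqVneq => //= x0; case: eqVneq => //= y0.
by rewrite valM //; apply: lerD.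
Qed.

Lemma val_ge_sum k (I : Type) (r : seq I) (P : pred I) (f : I -> F) :
  (forall i, P i -> ge k (f i)) -> ge k (\sum_(i <- r | P i) f i).
Proof. move=> kf; apply: (big_ind (fun x => ge k x)) => //;
  [exact: val_ge0|exact: val_geD]. Qed.

Lemma val_ge1 : ge 0 1. Proof. by rewrite /val_ge val1 lexx orbT. Qed.

Lemma val_ge_nat n : ge 0 n%:R.
Proof.
by elim: n => [|n IHn]; rewrite ?val_ge0 // -natr1; apply: val_geD;
  rewrite ?val_ge1.
Qed.

Definition mx_val_ge k p q (M : 'M[F]_(p, q)) := forall i j, ge k (M i j).

Lemma mx_val_geD k p q (M N : 'M[F]_(p, q)) :
  mx_val_ge k M -> mx_val_ge k N -> mx_val_ge k (M + N).
Proof. by move=> kM kN i j; rewrite mxE val_geD. Qed.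

Lemma mx_val_geM k l p q r (M : 'M[F]_(p, q)) (N : 'M[F]_(q, r)) :
  mx_val_ge k M -> mx_val_ge l N -> mx_val_ge (k + l) (M *m N).
Proof.
by move=> kM lN i j; rewrite mxE; apply: val_ge_sum => a _; apply: val_geM.
Qed.

Lemma mx_val_ge1 n : mx_val_ge 0 (1%:M : 'M_n).
Proof. by move=> i j; rewrite mxE val_ge_nat. Qed.

Lemma mx_val_geX n (M : 'M[F]_n) k : mx_val_ge 0 M -> mx_val_ge 0 (M ^+ k).
Proof.
move=> M0; elim: k => [|k IHk]; first by rewrite expr0; apply: mx_val_ge1.
by rewrite exprS -[0]addr0; apply: mx_val_geM.
Qed.

Lemma mx_val_geW k l p q (M : 'M[F]_(p, q)) :
  l <= k -> mx_val_ge k M -> mx_val_ge l M.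
Proof. by move=> lk kM i j; apply: val_geW lk _. Qed.

Lemma mx_val_ge_nat k n (M : 'M[F]_n) l : mx_val_ge k M -> mx_val_ge k (M *+ l).
Proof.
move=> kM; elim: l => [|l IHl]; last by rewrite mulrS; apply: mx_val_geD.
by move=> i j; rewrite mulr0n mxE val_ge0.
Qed.

(** The binomial expansion to first order. From [l] to [l.+1] the remainder [R] becomes
    [R + Z * R + (Z * Z) *+ l]. *)
Lemma expr_one_plus n (Z : 'M[F]_n) w l : 0 <= w -> mx_val_ge w Z ->
  mx_val_ge (w + w) ((1 + Z) ^+ l - 1 - Z *+ l).
Proof.
move=> w0 wZ; elim: l => [|l IHl].
  by move=> i j; rewrite expr0 subrr mulr0n subr0 mxE val_ge0.
set R := _ - _ in IHl;
  have -> : (1 + Z) ^+ l.+1 - 1 - Z *+ l.+1 = R + (Z * R + (Z * Z) *+ l).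
  have -> : (1 + Z) ^+ l.+1 = (1 + Z) * (R + 1 + Z *+ l) by rewrite exprS /R;
    congr (_ * _); rewrite addrAC !subrK.
  rewrite mulrDl mul1r !mulrDr mulr1 mulrnAr mulrS.
  move: (Z * R) (Z * Z *+ l) (Z *+ l) (1 : 'M_n) => X Y W U.
  by apply/matrixP => i j; rewrite !mxE; ring.
apply: mx_val_geD => //; apply: mx_val_geD; last exact/mx_val_ge_nat/mx_val_geM.
apply: (@mx_val_geW (w + (w + w))); [lra | exact: mx_val_geM].
Qed.

Lemma min_val_entry p q (Z : 'M[F]_(p, q)) : Z != 0 ->
  exists i j, Z i j != 0 /\ mx_val_ge (v (Z i j)) Z.
Proof.
move=> Z0; have [[i0 j0] nz0] : exists ij, Z ij.1 ij.2 != 0.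
  apply: contrapT => noij; case/eqP: Z0; apply/matrixP => i j; rewrite mxE.
  by apply: contrapT => /eqP Zij; apply: noij; exists (i, j).
case: (@arg_minP _ _ _ (i0, j0) (fun ij => Z ij.1 ij.2 != 0) (fun ij =>
  v (Z ij.1 ij.2)) nz0) => -[i j] /= nz min.
exists i, j; split=> // a b; rewrite /val_ge; case: eqVneq => //= nzab.
exact: (min (a, b)).
Qed.

(** If [Z = M - 1] is nonzero, let [w >= e + 1] be its least valuation. The linear term [Z *+ l] of
    the expansion of [M ^+ l = 1] has an entry of valuation at most [w + e < w + w], while the
    remainder has valuation at least [w + w]. *)
Lemma torsion_prime n (M : 'M[F]_n) l e :
    0 <= e -> l%:R != 0 :> F -> v l%:R <= e ->
    mx_val_ge (e + 1) (M - 1%:M) -> M ^+ l = 1 -> M = 1.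
Proof.
move=> e0 l0 le_l M1 Ml; apply/eqP; rewrite -subr_eq0; apply/negPn/negP => Z0.
have [i [j [nz minZ]]] := min_val_entry Z0; set Z := M - 1 in Z0 nz minZ.
have ge_w : e + 1 <= v (Z i j) by have := M1 i j; rewrite /val_ge (negPf nz).
have w0 : 0 <= v (Z i j) by lra.
have ZM : 1 + Z = M by rewrite addrC subrK.
have := expr_one_plus l w0 minZ i j; rewrite ZM Ml subrr sub0r.
have -> : (- (Z *+ l)) i j = - (Z i j * l%:R) by rewrite mxE -[Z *+
  l]scaler_nat mxE mulrC.
move=> /val_geN; rewrite opprK /val_ge.
by rewrite mulf_eq0 (negPf nz) (negPf l0) /= valM //; lra.
Qed.

(** For a prime [l] dividing [N], the matrix [M ^+ (N %/ l)] is still congruent to 1 and its [l]-th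
    power is 1. By the prime case it is 1, and [N] has decreased. *)
Lemma torsion_congruence n (M : 'M[F]_n) N e :
    0 <= e -> [pchar F] =i pred0 -> (forall l, prime l -> v l%:R <= e) ->
    mx_val_ge (e + 1) (M - 1%:M) -> (0 < N)%N -> M ^+ N = 1 -> M = 1.
Proof.
move=> e0 char0 le_e; have [k] := ubnP N;
  elim: k N M => // k IHk N M ltNk M1 N0 MN.
have [N1|gtN1] := leqP N 1;
  first by have -> : M = M ^+ N by have -> : N = 1%N by lia.
pose l := pdiv N; have l_pr : prime l := pdiv_prime gtN1.
have defN : N = (N %/ l * l)%N by rewrite divnK ?pdiv_dvd.
have N'0 : (0 < N %/ l)%N by lia.
apply: (IHk (N %/ l)%N) => //;
  first by apply: leq_trans (ltn_Pdiv (prime_gt1 l_pr) N0) _; rewrite -ltnS.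
apply: (@torsion_prime _ _ l e) => //; last by rewrite -exprM -defN.
- by rewrite ((pcharf0P F).1 char0) -lt0n prime_gt0.
- exact: le_e.
have M0 : mx_val_ge 0 M.
  rewrite -[M](subrK 1%:M); apply: mx_val_geD (@mx_val_ge1 _).
  by apply: mx_val_geW M1; lra.
rewrite -[1%:M]/(1 : 'M_n) subrX1 -[e + 1]addr0.
apply: mx_val_geM => // i j; rewrite summxE; apply: val_ge_sum => a _.
exact: mx_val_geX.
Qed.

(** Only one prime, the residue characteristic, can have positive valuation: by Bezout, two of them
    would give 1 positive valuation. *)
Lemma prime_val_bound : [pchar F] =i pred0 ->
  exists2 e : int, 0 <= e & forall l, prime l -> v l%:R <= e.
Proof.
move=> char0; have nat0 l : prime l -> l%:R != 0 :> F.
  by move=> l_pr; rewrite ((pcharf0P F).1 char0) -lt0n prime_gt0.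
have [[p [p_pr vp]]|none] := pselect (exists p, prime p /\ 0 < v p%:R);
  last first.
  exists 0 => // l l_pr; rewrite leNgt; apply/negP => vl.
  by apply: none; exists l.
exists (v p%:R); first exact: ltW.
move=> l l_pr; have [->//|neq_lp] := eqVneq l p.
apply: le_trans (ltW vp); rewrite leNgt; apply/negP => vl.
have cop : coprime l p by rewrite prime_coprime // dvdn_prime2 //
  (negPf neq_lp).
have [[a b] /= ab1] := elimT (coprimeP p (prime_gt0 l_pr)) cop.
suff: ge 1 1 by rewrite /val_ge oner_eq0 val1.
have -> : 1 = a%:R * l%:R - b%:R * p%:R :> F.
  by rewrite -!natrM -natrB ?ab1 // ltnW // -subn_gt0 ab1.
have vmul (c q : nat) : 0 < v q%:R -> ge 1 (c%:R * q%:R).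
  move=> vq; apply: (@val_geM 0 1 _ _ (val_ge_nat c)).
  by rewrite /val_ge; apply/orP; right; lia.
by apply: val_geB; apply: vmul.
Qed.

(** Expansion in digits: subtract a representative of the residue class, divide by the uniformiser
    [p], and approximate the quotient. *)
Lemma finite_quotient : finite_residue_field v -> forall k : nat,
  exists s : seq F, forall x, ge 0 x -> exists2 a, a \in s & ge k%:Z (x - a).
Proof.
case=> s0 s0P; have [p p0 vp] : exists2 p, p != 0 & v p = 1 by case: valv.
elim=> [|k [s sP]].
  by exists [:: 0] => x x0; exists 0; rewrite ?mem_head // subr0.
exists [seq a + p * b | a <- s0, b <- s] => x /s0P[a as0 xa].
have [|b bs xab] := sP ((x - a) / p).
  move: xa; rewrite /val_ge mulf_eq0; case: eqVneq => //= xa0 vxa.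
  have : v (x - a) = v ((x - a) / p) + v p by rewrite -valM ?divfK //
    mulf_neq0 ?invr_eq0.
  by move=> E; apply/orP; right; move: E vxa; rewrite vp; lra.
exists (a + p * b); first exact: allpairs_f.
have -> : x - (a + p * b) = p * ((x - a) / p - b).
  by rewrite mulrBr mulrCA divff // mulr1 opprD addrA.
rewrite intS; apply: val_geM => //.
by rewrite /val_ge vp lexx orbT.
Qed.

(** Let [L] count the matrices with entries in a finite set of representatives. Two of the powers of
    [C] with exponents from 0 to [L] are congruent, so [C ^+ (j - i)] is 1 by absence of torsion,
    and [j - i] divides the factorial of [L]. *)
Lemma integral_torsion_exponent d : [pchar F] =i pred0 ->
  finite_residue_field v ->
  exists2 m, (0 < m)%N & forall (C : 'M[F]_d) N,
    mx_val_ge 0 C -> (0 < N)%N -> C ^+ N = 1 -> C ^+ m = 1.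
Proof.
move=> char0 finv; have [e e0 le_e] := prime_val_bound char0.
have [s sP] := finite_quotient finv (absz (e + 1)).
have {}sP x : ge 0 x -> exists2 a, a \in s & ge (e + 1) (x - a).
  by move=> /sP; rewrite gez0_abs ?addr_ge0.
pose L := #|{: 'M[seq_sub s]_d}|; exists L`!; first exact: fact_gt0.
move=> C N C0 N0 CN.
have approx i : exists M : 'M[seq_sub s]_d,
  mx_val_ge (e + 1) (C ^+ i - map_mx val M).
  have /choice[f fP] ab : exists a : seq_sub s,
    ge (e + 1) ((C ^+ i) ab.1 ab.2 - val a).
    by have [a as_ aP] := sP _ (mx_val_geX i C0 ab.1 ab.2); exists (SeqSub as_).
  by exists (\matrix_(a, b) f (a, b)) => a b; rewrite !mxE; apply: (fP (a, b)).
have [f fP] := choice approx.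
have /injectivePn[i [j neq_ij eq_ij]] : ~~ injectiveb (fun i : 'I_L.+1 => f i).
  apply/negP => /injectiveP inj_f.
  by have := leq_card _ inj_f; rewrite card_ord ltnn.
wlog lt_ij : i j neq_ij eq_ij / (i < j)%N.
  move=> IH; have [|lt_ji|/val_inj eq_ij'] := ltngtP i j; first exact: IH.
    by apply: (IH j i) => //; rewrite eq_sym.
  by rewrite eq_ij' eqxx in neq_ij.
have cong : mx_val_ge (e + 1) (C ^+ j - C ^+ i).
  have -> : C ^+ j - C ^+ i = (C ^+ j - map_mx val (f j)) + - (C ^+ i - map_mx
    val (f i)).
    by rewrite eq_ij opprB addrA subrK.
  by apply: mx_val_geD (fP j) _ => a b; rewrite mxE; apply: val_geN; apply: fP.
have Cji : C ^+ (j - i) = 1.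
  apply: (torsion_congruence e0 char0 le_e _ N0);
    last by rewrite exprAC CN expr1n.
  (* As [C ^+ N = 1], the first factor is the inverse of [C ^+ i], in a form that is visibly
     integral. *)
  have -> : C ^+ (j - i) - 1%:M = C ^+ (N * i - i) *m (C ^+ j - C ^+ i).
    have le_i : (i <= N * i)%N by rewrite leq_pmull.
    rewrite mulmxBr mulmxE -!exprD subnK // exprM CN expr1n.
    have -> : (N * i - i + j = N * i + (j - i))%N by lia.
    by rewrite exprD exprM CN expr1n mul1r.
  by rewrite -[e + 1]add0r; apply: mx_val_geM => //; apply: mx_val_geX.
have /dvdnP[c ->] : (j - i %| L`!)%N.
  by apply: dvdn_fact; rewrite subn_gt0 lt_ij /=; have := ltn_ord j; lia.
by rewrite mulnC exprM Cji expr1n.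
Qed.

(* Gauss: the contents of R and S add up to that of R * S, and a monic
   polynomial has content at most 0. *)
Lemma monic_factor_integral (R S : {poly F}) :
    R \is monic -> S \is monic -> (forall i, ge 0 (R * S)`_i) ->
  forall i, ge 0 R`_i.
Proof.
move=> monR monS RS0.
have content (P : {poly F}) : P \is monic ->
    exists i, [/\ P`_i != 0, v P`_i <= 0, forall j, ge (v P`_i) P`_j &
      forall j, (j < i)%N -> ge (v P`_i + 1) P`_j].
  move=> monP; pose Z := poly_rV P : 'rV_(size P).
  have PZ : P = rVpoly Z by rewrite poly_rV_K.
  have Z0 : Z != 0.
    by apply: contraTneq monP => Z0;
      rewrite PZ Z0 linear0 monicE lead_coef0 eq_sym oner_eq0.
  have [a [b [nz minZ]]] := min_val_entry Z0.
  have Zb c : Z a c = P`_c by rewrite mxE.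
  have minP j : ge (v P`_b) P`_j.
    have [lt_j|ge_j] := ltnP j (size P);
      last by rewrite (nth_default 0 ge_j) val_ge0.
    by have := minZ a (Ordinal lt_j); rewrite !Zb.
  have ex_i : exists i, (P`_i != 0) && (v P`_i == v P`_b).
    by exists b; rewrite eqxx andbT -(Zb b).
  case: (ex_minnP ex_i) => i /andP[nzi /eqP vi] first_i.
  exists i; split=> //; rewrite ?vi //.
    (* The leading coefficient 1 has valuation 0, which bounds the minimum. *)
    have := minP (size P).-1; rewrite -lead_coefE (monicP monP).
    by rewrite /val_ge oner_eq0 val1.
  move=> j lt_ji; have := minP j; rewrite /val_ge.
  case: eqVneq => //= nzj le_v.
  have neq_v : v P`_j != v P`_b.
    by apply/negP => eq_v; have := first_i j;
      rewrite nzj eq_v leqNgt lt_ji => /(_ isT).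
  by move: (v P`_j) (v P`_b) le_v neq_v => x y; lia.
have [i [nzi vi minR firstR]] := content R monR.
have [j [nzj vj minS firstS]] := content S monS.
suff vij : 0 <= v R`_i + v S`_j by move=> k; apply: val_geW (minR k); lra.
have ij_lt : (i < (i + j).+1)%N by rewrite ltnS leq_addr.
(* Any other term of this coefficient has an index below [i] in [R] or below [j] in [S], hence a
   larger valuation, so it cannot cancel the chosen term. *)
have := RS0 (i + j)%N; rewrite coefM (bigD1 (Ordinal ij_lt)) //= addKn.
set T := \sum_(_ < _ | _) _ => vRS.
have vT : ge (v R`_i + v S`_j + 1) T.
  apply: val_ge_sum => k neq_k.
  have [lt_ki|] := ltnP k i.
    rewrite addrAC; apply: val_geM; [exact: firstR | exact: minS].
  rewrite leq_eqVlt => /orP[/eqP eq_ik|lt_ik].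
    by case/eqP: neq_k; apply: val_inj.
  by rewrite -addrA; apply: val_geM; [exact: minR | apply: firstS;
    have := ltn_ord k; lia].
rewrite leNgt; apply/negP => neg.
have : ge (v R`_i + v S`_j + 1) (R`_i * S`_j).
  rewrite -[_ * _](addrK T); apply: val_geB => //.
  by apply: val_geW vRS; move: (v R`_i) (v S`_j) neg => x y; lia.
by rewrite /val_ge mulf_eq0 (negPf nzi) (negPf nzj) /= valM //; lra.
Qed.

Lemma companion_integral (R : {poly F}) :
  (forall i, ge 0 R`_i) -> mx_val_ge 0 (companionmx R).
Proof.
move=> R0 i j; rewrite mxE; case: ifP => _; last exact: val_ge_nat.
exact: val_geN.
Qed.

End Valuation.

(** The monic gcd [R] of [P] and ['X^N - 1] vanishes at [z], and it is integral by Gauss as a factor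
    of ['X^N - 1]. Its companion matrix is then integral, of finite order, with eigenvalue [z]. *)
Lemma local_field_bounded_torsion (F : fieldType) d :
    nonarch_local_field F -> [pchar F] =i pred0 ->
  exists2 m, (0 < m)%N & bounded_torsion F d m.
Proof.
move=> [v [valv _ finv]] char0.
have /choice[m_ mP] D : exists m, (0 < m)%N /\ forall (C : 'M[F]_D) N,
    mx_val_ge v 0 C -> (0 < N)%N -> C ^+ N = 1 -> C ^+ m = 1.
  by have [m m0 mP] := integral_torsion_exponent valv D char0 finv; exists m.
(* The companion matrix may have any size up to [d], so the exponents for all these sizes are
   multiplied. *)
exists (\prod_(D < d.+1) m_ D)%N.
  by apply: prodn_gt0 => D; case: (mP D).
move=> E i P z N N0 zN monP szP rPz.
pose Q := 'X^N - 1 : {poly F}; pose G := gcdp P Q.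
have monQ : Q \is monic by apply: monicXnsubC.
have G0 : G != 0 by rewrite gcdp_eq0 (negPf (monic_neq0 monP)).
pose R := (lead_coef G)^-1 *: G.
have lG : lead_coef G != 0 by rewrite lead_coef_eq0.
have monR : R \is monic by rewrite monicE lead_coefZ mulVf.
have RP : R %| P by rewrite dvdpZl ?invr_eq0 // dvdp_gcdl.
have RQ : R %| Q by rewrite dvdpZl ?invr_eq0 // dvdp_gcdr.
have rRz : root (map_poly i R) z.
  rewrite map_polyZ rootZ ?fmorph_eq0 ?invr_eq0 // gcdp_map root_gcd rPz /=.
  by rewrite rmorphB rmorphXn rmorph1 /= map_polyX /root !hornerE zN subrr.
have [S defQ] : exists S, Q = S * R by apply/dvdpP.
have monS : S \is monic by move: monQ; rewrite defQ monicMr.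
have R_int : forall k, val_ge v 0 R`_k.
  apply: (monic_factor_integral valv monR monS) => k;
    rewrite mulrC -defQ coefB coefXn coef1.
  by apply: val_geB; rewrite ?val_ge_nat.
pose C := companionmx R.
have pC : char_poly C = R := companionmxK monR.
have szR : ((size R).-1 < d.+1)%N.
  by rewrite (leq_trans _ szP) // prednK ?size_poly_gt0 ?dvdp_leq ?monic_neq0.
have CN : C ^+ N = 1.
  (* Generalising over the size sets the empty matrix apart before Cayley-Hamilton is applied. *)
  have : forall D (C' : 'M[F]_D), char_poly C' = R -> C' ^+ N = 1.
    case=> [|D] C' pC'; first by rewrite [LHS]flatmx0 [RHS]flatmx0.
    have := congr1 (horner_mx C') defQ;
      rewrite rmorphM /= -[in X in _ * X]pC' Cayley_Hamilton mulr0.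
    by rewrite rmorphB rmorphXn rmorph1 /= horner_mx_X => /eqP;
      rewrite subr_eq0 => /eqP.
  exact.
have Cm : C ^+ m_ (size R).-1 = 1.
  by case: (mP (size R).-1) => _ /(_ C N) -> //; apply: companion_integral.
have zm : z ^+ m_ (size R).-1 = 1.
  have : root (char_poly (map_mx i C)) z by rewrite -map_char_poly pC.
  rewrite -eigenvalue_root_char => /eigenvalueP[w wC w0].
  have wCk k : w *m map_mx i C ^+ k = z ^+ k *: w.
    elim: k => [|k IHk]; first by rewrite !expr0 mulmx1 scale1r.
    by rewrite exprSr -mulmxE mulmxA IHk -scalemxAl wC scalerA exprSr.
  have := wCk (m_ (size R).-1); rewrite -rmorphXn Cm rmorph1 mulmx1 => /eqP.
  rewrite -subr_eq0 -{1}[w]scale1r -scalerBl scaler_eq0 (negPf w0) orbF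
    subr_eq0.
  by move/eqP => <-.
by rewrite (bigD1 (Ordinal szR)) //= exprM zm expr1n.
Qed.

(** * Identity components *)

(** Starting from 0, add vectors of [P] until none is left out; the rank grows each time. *)
Lemma subspace_mx (F : fieldType) n (P : 'rV[F]_n -> Prop) :
    P 0 -> (forall a u w, P u -> P w -> P (a *: u + w)) ->
  exists X : 'M[F]_n, forall u, (u <= X)%MS <-> P u.
Proof.
move=> P0 Plin.
suff [X XP maxX] : exists2 X : 'M[F]_n, forall u : 'rV_n, (u <= X)%MS -> P u &
    forall u, P u -> (u <= X)%MS by exists X => u; split;
      [apply: XP | apply: maxX].
have Pz a u : P u -> P (a *: u) by move=> Pu; rewrite -[_ *: _]addr0;
  apply: Plin.
suff ext k (X : 'M[F]_n) : (forall u : 'rV_n, (u <= X)%MS -> P u) ->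
    (n - \rank X < k)%N ->
    exists2 X : 'M[F]_n, forall u : 'rV_n, (u <= X)%MS ->
      P u & forall u, P u -> (u <= X)%MS.
  by apply: (ext _ 0 _ (ltnSn _)) => u; rewrite submx0 => /eqP->.
elim: k X => // k IHk X XP lt_k.
have [maxX|] := pselect (forall u, P u -> (u <= X)%MS); first by exists X.
case/existsNP=> u /not_implyP[Pu /negP not_uX].
have ltX : (X < X + u)%MS by rewrite ltmxE addsmxSl addsmx_sub submx_refl.
apply: (IHk (X + u)%MS) => [w /sub_addsmxP[[a b] /= ->]|].
  rewrite addrC [b]mx11_scalar mul_scalar_mx; apply: Plin => //.
  by apply: XP; apply: submxMl.
have := rank_leq_row (X + u)%MS; have := rank_ltmx ltX; lia.
Qed.

Section LinearZariski.
Variables (F : fieldType) (G : groupType) (N : nat) (phi : G -> 'rV[F]_N).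

(** Equivalently, the span of the entries of [phi] is stable under left and right translations. *)
Definition translation_linear : Prop :=
  (forall x, exists A : 'M[F]_N, forall g, phi (x * g)%g = phi g *m A) /\
  (forall x, exists A : 'M[F]_N, forall g, phi (g * x)%g = phi g *m A).

(** Only linear conditions on [phi] are used. Such sets are stable under intersection but in general
    not under union, so irreducibility is tested on coverings by two of them. *)
Definition zclosed (Z : G -> Prop) : Prop :=
  exists L : 'M[F]_N, forall g, Z g <-> (phi g <= L)%MS.

Definition zirreducible (S : G -> Prop) : Prop :=
  forall Z1 Z2, zclosed Z1 -> zclosed Z2 ->
    (forall g, S g -> Z1 g \/ Z2 g) ->
    (forall g, S g -> Z1 g) \/ (forall g, S g -> Z2 g).

(* For a group in the Zariski topology this is the identity component. *)
Definition zcomponent (x : G) : Prop :=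
  exists S, [/\ zirreducible S, S 1%g & S x].

Hypothesis trans : translation_linear.

Lemma zclosed_bigcap (I : Type) (Z : I -> G -> Prop) :
  (forall i, zclosed (Z i)) -> zclosed (fun g => forall i, Z i g).
Proof.
move=> /choice[L LP].
have [|a u w uL wL i|X XP] :=
    @subspace_mx F N (fun u => forall i, (u <= L i)%MS).
- by move=> i; apply: sub0mx.
- by rewrite addmx_sub ?scalemx_sub.
by exists X => g; rewrite XP; split=> Zg i; apply/LP.
Qed.

Lemma zclosed_preim (A : 'M[F]_N) (f : G -> G) Z :
  (forall g, phi (f g) = phi g *m A) -> zclosed Z -> zclosed (fun g => Z (f g)).
Proof.
move=> fA [L LP].
have [|a u w uL wL|X XP] := @subspace_mx F N (fun u => (u *m A <= L)%MS).
- by rewrite mul0mx sub0mx.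
- by rewrite mulmxDl -scalemxAl addmx_sub ?scalemx_sub.
by exists X => g; rewrite XP -fA; apply: LP.
Qed.

Lemma zclosed_mull x Z : zclosed Z -> zclosed (fun g => Z (x * g)%g).
Proof. by case: trans => /(_ x)[A AP] _; apply: zclosed_preim AP. Qed.

Lemma zclosed_mulr x Z : zclosed Z -> zclosed (fun g => Z (g * x)%g).
Proof. by case: trans => _ /(_ x)[A AP]; apply: zclosed_preim AP. Qed.

Lemma zirreducible_mull x S :
  zirreducible S -> zirreducible (fun g => S (x * g)%g).
Proof.
move=> irrS Z1 Z2 /(zclosed_mull x^-1) cl1 /(zclosed_mull x^-1) cl2 cover.
case: (irrS _ _ cl1 cl2) => [g Sg|sub|sub].
- by apply: cover; rewrite mulVKg.
- by left=> g /sub; rewrite mulKg.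
- by right=> g /sub; rewrite mulKg.
Qed.

Lemma zirreducible_mulr x S :
  zirreducible S -> zirreducible (fun g => S (g * x)%g).
Proof.
move=> irrS Z1 Z2 /(zclosed_mulr x^-1) cl1 /(zclosed_mulr x^-1) cl2 cover.
case: (irrS _ _ cl1 cl2) => [g Sg|sub|sub].
- by apply: cover; rewrite mulgVK.
- by left=> g /sub; rewrite mulgK.
- by right=> g /sub; rewrite mulgK.
Qed.

(* Separate continuity of the multiplication suffices. *)
Lemma zirreducible_prod S T : zirreducible S -> zirreducible T ->
  zirreducible (fun g => exists x y, [/\ S x, T y & g = x * y]%g).
Proof.
move=> irrS irrT Z1 Z2 cl1 cl2 cover.
have cl Z : zclosed Z -> zclosed (fun x =>
  forall y : {y | T y}, Z (x * sval y)%g).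
  by move=> clZ; apply: zclosed_bigcap => y; apply: zclosed_mulr.
case: (irrS _ _ (cl _ cl1) (cl _ cl2)) => [x Sx|sub|sub].
- have [y Ty|sub|sub] := irrT _ _ (zclosed_mull x cl1) (zclosed_mull x cl2).
  + by apply: cover; exists x, y.
  + by left=> -[y Ty]; apply: sub.
  + by right=> -[y Ty]; apply: sub.
- by left=> _ [x [y [Sx Ty ->]]]; apply: (sub x Sx (exist _ y Ty)).
- by right=> _ [x [y [Sx Ty ->]]]; apply: (sub x Sx (exist _ y Ty)).
Qed.

Lemma zcomponent1 : zcomponent 1%g.
Proof.
exists (fun g => g = 1%g); split=> // Z1 Z2 _ _ cover.
by have [] := cover 1%g erefl; [left|right] => g ->.
Qed.

Lemma zcomponentM x y : zcomponent x -> zcomponent y -> zcomponent (x * y)%g.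
Proof.
move=> [S [irrS S1 Sx]] [T [irrT T1 Ty]].
exists (fun g => exists x y, [/\ S x, T y & g = x * y]%g).
split; first exact: zirreducible_prod.
  by exists 1%g, 1%g; rewrite mulg1.
by exists x, y.
Qed.

(** Translation by [x^-1] moves [x] to 1 and 1 to [x^-1]. *)
Lemma zcomponentV x : zcomponent x -> zcomponent x^-1%g.
Proof.
move=> [S [irrS S1 Sx]]; exists (fun g => S (x * g)%g).
by split; [apply: zirreducible_mull | rewrite mulg1 | rewrite mulgV].
Qed.

Lemma zcomponentJ x g : zcomponent x -> zcomponent (g^-1 * x * g)%g.
Proof.
move=> [S [irrS S1 Sx]]; exists (fun y => S (g * y * g^-1)%g); split.
- exact/(zirreducible_mull (S := fun y => S (y * g^-1)%g))/zirreducible_mulr.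
- by rewrite mulg1 mulgV.
- by rewrite !mulgA mulgV mul1g mulgK.
Qed.

(** Induction on the rank of a linear condition [L]. If it cuts out an irreducible set, that set
    lies in one coset of the component. Otherwise two closed sets cover it, neither containing it,
    and intersecting [L] with either lowers the rank. *)
Lemma zcomponent_finite_index :
  exists s : seq G, forall g, exists2 a, a \in s & zcomponent (a^-1 * g)%g.
Proof.
suff cover k (L : 'M[F]_N) : (\rank L < k)%N ->
    exists s : seq G, forall g, (phi g <= L)%MS ->
      exists2 a, a \in s & zcomponent (a^-1 * g)%g.
  have [s sP] := cover _ 1%:M (ltnSn _).
  by exists s => g; apply: sP; apply: submx1.
elim: k L => // k IHk L ltLk.
have [irrL|redL] := pselect (zirreducible (fun g => phi g <= L)%MS).
  have [[a aL]|none] := pselect (exists a, (phi a <= L)%MS); last first.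
    by exists [::] => g gL; case: none; exists g.
  exists [:: a] => g gL; exists a; rewrite ?mem_head //.
  exists (fun x => phi (a * x)%g <= L)%MS.
  by split; [apply: zirreducible_mull irrL | rewrite mulg1 | rewrite mulVKg].
have [Z1 [Z2 [[L1 cl1] [L2 cl2] cover [g1 [g1L Zg1]] [g2 [g2L Zg2]]]]] :
    exists Z1 Z2, [/\ zclosed Z1, zclosed Z2,
      forall g, (phi g <= L)%MS -> Z1 g \/ Z2 g,
      exists g, (phi g <= L)%MS /\ ~ Z1 g & exists g,
        (phi g <= L)%MS /\ ~ Z2 g].
  apply: contrapT => no; apply: redL => Z1 Z2 cl1 cl2 cover.
  have [sub|/existsNP[g1 /not_implyP n1]] :=
    pselect (forall g, (phi g <= L)%MS -> Z1 g); first by left.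
  have [sub|/existsNP[g2 /not_implyP n2]] :=
    pselect (forall g, (phi g <= L)%MS -> Z2 g); first by right.
  by case: no; exists Z1, Z2; split=> //; [exists g1 | exists g2].
have step (L' : 'M[F]_N) g : (phi g <= L)%MS -> ~ (phi g <= L')%MS ->
  (\rank (L :&: L') < k)%N.
  move=> gL gL'; apply: leq_trans (_ : \rank L <= k)%N => //; apply: rank_ltmx.
  rewrite ltmxE capmxSl /=; apply/negP => LL'; apply: gL'.
  by apply: submx_trans gL (submx_trans LL' (capmxSr _ _)).
have [s1 s1P] := IHk _ (step L1 g1 g1L (fun h => Zg1 ((cl1 g1).2 h))).
have [s2 s2P] := IHk _ (step L2 g2 g2L (fun h => Zg2 ((cl2 g2).2 h))).
exists (s1 ++ s2) => g gL; case: (cover g gL) => [/cl1 gL1|/cl2 gL2].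
  have [|a as1 aP] := s1P g; first by rewrite sub_capmx gL.
  by exists a; rewrite // mem_cat as1.
have [|a as2 aP] := s2P g; first by rewrite sub_capmx gL.
by exists a; rewrite // mem_cat as2 orbT.
Qed.

(** An irreducible set through 1 lies in [Z1] or in [Z2], and the point 1 excludes [Z1]. *)
Lemma zcomponent_closed Z1 Z2 : zclosed Z1 -> zclosed Z2 ->
  (forall g, Z1 g \/ Z2 g) -> ~ Z1 1%g -> forall x, zcomponent x -> Z2 x.
Proof.
move=> cl1 cl2 cover Z11 x [S [irrS S1 Sx]].
by have [g _|/(_ _ S1) //|] := irrS _ _ cl1 cl2; [apply: cover | apply].
Qed.

End LinearZariski.

(** * Functions whose translates span a finite-dimensional space *)

Section Regular.
Variables (F : fieldType) (G : groupType).
Implicit Types f h : G -> F.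

Definition coefficient N (phi : G -> 'rV[F]_N) f : Prop :=
  exists c : 'cV[F]_N, forall g, f g = (phi g *m c) 0 0.

(** Each function comes with its own [phi], so that sums and products may use larger ones. *)
Definition regular f : Prop :=
  exists N (phi : G -> 'rV[F]_N), translation_linear phi /\ coefficient phi f.

Lemma zclosed_coefficient N (phi : G -> 'rV[F]_N) f :
  coefficient phi f -> zclosed phi (fun g => f g = 0).
Proof.
case=> c fc; exists (kermx c) => g; split=> [fg|/sub_kermxP]; last first.
  by rewrite fc => ->; rewrite mxE.
by apply/sub_kermxP; rewrite [LHS]mx11_scalar -fc fg raddf0.
Qed.

Lemma regular_ext f h : f =1 h -> regular f -> regular h.
Proof. by move/funext ->. Qed.

(** The direct sum of the two families serves both functions. A common [phi] matters because closed
    sets and components are relative to one. *)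
Lemma regular2 f h : regular f -> regular h ->
  exists N (phi : G -> 'rV[F]_N),
    [/\ translation_linear phi, coefficient phi f & coefficient phi h].
Proof.
move=> [N1 [phi1 [[l1 r1] [c1 f1]]]] [N2 [phi2 [[l2 r2] [c2 f2]]]].
exists (N1 + N2)%N, (fun g => row_mx (phi1 g) (phi2 g)); split.
- split=> x.
    have [[A1 A1P] [A2 A2P]] := (l1 x, l2 x); exists (block_mx A1 0 0 A2) => g.
    by rewrite A1P A2P mul_row_block !mulmx0 addr0 add0r.
  have [[A1 A1P] [A2 A2P]] := (r1 x, r2 x); exists (block_mx A1 0 0 A2) => g.
  by rewrite A1P A2P mul_row_block !mulmx0 addr0 add0r.
- by exists (col_mx c1 0) => g; rewrite mul_row_col mulmx0 addr0.
- by exists (col_mx 0 c2) => g; rewrite mul_row_col mulmx0 add0r.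
Qed.

Lemma regularD f h : regular f -> regular h -> regular (fun g => f g + h g).
Proof.
move=> rf rh; have [N [phi [tr [c fc] [d hd]]]] := regular2 rf rh.
exists N, phi; split=> //; exists (c + d) => g.
by rewrite fc hd mulmxDr [RHS]mxE.
Qed.

Lemma regularM f h : regular f -> regular h -> regular (fun g => f g * h g).
Proof.
move=> [N1 [phi1 [[l1 r1] [c1 f1]]]] [N2 [phi2 [[l2 r2] [c2 f2]]]].
(* This is the tensor product of [phi1 g] and [phi2 g]. *)
exists (N1 * N2)%N, (fun g => mxvec ((phi1 g)^T *m phi2 g)); split.
  have lin (A1 : 'M[F]_N1) (A2 : 'M[F]_N2) (u : 'rV_N1) (w : 'rV_N2) :
      mxvec ((u *m A1)^T *m (w *m A2)) =
      mxvec (u^T *m w) *m (lin_mulmx A1^T *m lin_mulmxr A2).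
    by rewrite [RHS]mulmxA !mul_vec_lin /= trmx_mul !mulmxA.
  split=> x.
    have [[A1 A1P] [A2 A2P]] := (l1 x, l2 x).
    by exists (lin_mulmx A1^T *m lin_mulmxr A2) => g; rewrite A1P A2P lin.
  have [[A1 A1P] [A2 A2P]] := (r1 x, r2 x).
  by exists (lin_mulmx A1^T *m lin_mulmxr A2) => g; rewrite A1P A2P lin.
(* The functional [M |-> c1^T *m M *m c2] takes the value [f g * h g] at this tensor. *)
exists (lin1_mx (mulmxr c2 \o mulmx c1^T \o vec_mx)) => g.
by rewrite mul_rV_lin1 /= mxvecK -!mulmxA mulmxA -trmx_mul f1 f2 [RHS]mxE
  big_ord1 [in RHS]mxE.
Qed.

Lemma regular_const a : regular (fun=> a).
Proof.
exists 1%N, (fun=> 1%:M); split; last by exists a%:M => g;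
  rewrite mul1mx mxE eqxx.
by split=> x; exists 1%:M => g; rewrite mulmx1.
Qed.

Lemma regularB f h : regular f -> regular h -> regular (fun g => f g - h g).
Proof.
move=> rf rh; apply: regularD rf _;
  apply: regular_ext (regularM (regular_const (-1)) rh) => g.
by rewrite mulN1r.
Qed.

Lemma regular_sum (I : Type) (r : seq I) (P : pred I) (f : I -> G -> F) :
  (forall i, regular (f i)) -> regular (fun g => \sum_(i <- r | P i) f i g).
Proof.
move=> rf; elim: r => [|i r IHr].
  by apply: regular_ext (regular_const 0) => g; rewrite big_nil.
have [Pi|nPi] := boolP (P i).
  by apply: regular_ext (regularD (rf i) IHr) => g; rewrite big_cons Pi.
by apply: regular_ext IHr => g; rewrite big_cons (negPf nPi).
Qed.

Lemma regular_prod (I : Type) (r : seq I) (f : I -> G -> F) :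
  (forall i, regular (f i)) -> regular (fun g => \prod_(i <- r) f i g).
Proof.
move=> rf; elim: r => [|i r IHr].
  by apply: regular_ext (regular_const 1) => g; rewrite big_nil.
by apply: regular_ext (regularM (rf i) IHr) => g; rewrite big_cons.
Qed.

Definition mx_regular p q (M : G -> 'M[F]_(p, q)) : Prop :=
  forall i j, regular (fun g => M g i j).

Lemma mx_regularM p q r (M : G -> 'M[F]_(p, q)) (M' : G -> 'M[F]_(q, r)) :
  mx_regular M -> mx_regular M' -> mx_regular (fun g => M g *m M' g).
Proof.
move=> rM rM' i j.
apply: regular_ext (regular_sum _ _ (fun k => regularM (rM i k) (rM' k j))) =>
  g.
by rewrite mxE.
Qed.

Lemma mx_regular_sum (I : Type) (r : seq I) p q (M : I -> G -> 'M[F]_(p, q)) :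
  (forall i, mx_regular (M i)) -> mx_regular (fun g => \sum_(i <- r) M i g).
Proof.
move=> rM i j; apply: regular_ext (regular_sum r xpredT (fun k => rM k i j)) =>
  g.
by rewrite summxE.
Qed.

Lemma mx_regularX n (M : G -> 'M[F]_n) k :
  mx_regular M -> mx_regular (fun g => M g ^+ k).
Proof.
move=> rM; elim: k => [|k IHk].
  by move=> i j; apply: regular_ext (regular_const ((1%:M : 'M[F]_n) i j)) =>
    g; rewrite expr0.
by move=> i j; apply: regular_ext (mx_regularM rM IHk i j) => g; rewrite exprS.
Qed.

Lemma mx_regular_linear p q r t (M : G -> 'M[F]_(p, q))
    (T : {linear 'M[F]_(p, q) -> 'M[F]_(r, t)}) :
  mx_regular M -> mx_regular (fun g => T (M g)).
Proof.
move=> rM i j.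
have := regular_sum (index_enum _) xpredT (fun a =>
  regular_sum (index_enum _) xpredT
  (fun b => regularM (rM a b) (regular_const (T (delta_mx a b) i j)))).
apply: regular_ext => g;
  rewrite [in RHS](matrix_sum_delta (M g)) linear_sum summxE.
apply: eq_bigr => a _; rewrite linear_sum summxE; apply: eq_bigr => b _.
by rewrite linearZ [RHS]mxE.
Qed.

Lemma regular_det n (M : G -> 'M[F]_n) :
  mx_regular M -> regular (fun g => \det (M g)).
Proof.
move=> rM; apply: regular_sum => s; apply: regularM; first exact: regular_const.
by apply: regular_prod => i; apply: rM.
Qed.

Lemma regular_trace n (M : G -> 'M[F]_n) :
  mx_regular M -> regular (fun g => \tr (M g)).
Proof. by move=> rM; apply: regular_sum => i; apply: rM. Qed.

Lemma mx_regular_repr n (rho : gl_repr F G n) : mx_regular rho.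
Proof.
move=> i j; exists (n * n)%N, (fun g => mxvec (rho g)); split.
  split=> x; [exists (lin_mulmx (rho x)) | exists (lin_mulmxr (rho x))] => g;
  by rewrite gl_reprM mul_vec_lin.
by exists (delta_mx (mxvec_index i j) 0) => g; rewrite -colE mxE mxvecE.
Qed.

(** The zeros of [f] and those of [h] are closed for a common [phi] and cover [G]. As [f] is nonzero
    at 1, the component of 1 consists of zeros of [h]. *)
Lemma regular_component f h : regular f -> regular h ->
    (forall g, f g * h g = 0) -> f 1%g != 0 ->
  exists H : {pred G}, [/\ finite_index_subgroup H,
    forall x g, x \in H -> (g^-1 * x * g)%g \in H & {in H, forall x, h x = 0}].
Proof.
move=> rf rh fh0 f1; have [N [phi [tr cf ch]]] := regular2 rf rh.
pose H : {pred G} := fun x => `[< zcomponent phi x >].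
have memE x : (x \in H) = `[< zcomponent phi x >] by [].
exists H; split.
- split.
    split; first by rewrite memE; apply/asboolP/zcomponent1.
    move=> x y; rewrite !memE => /asboolP Hx /asboolP Hy; apply/asboolP.
    by apply: zcomponentM => //; apply: zcomponentV.
  have [s sP] := zcomponent_finite_index tr.
  by exists s => g; have [a as_ aP] := sP g; exists a => //; rewrite memE;
    apply/asboolP.
- by move=> x g; rewrite !memE => /asboolP Hx; apply/asboolP/zcomponentJ.
- move=> x; rewrite memE => /asboolP.
  apply: (@zcomponent_closed _ _ _ phi (fun g => f g = 0) (fun g => h g = 0)).
  + exact: zclosed_coefficient cf.
  + exact: zclosed_coefficient ch.
  + by move=> g; have /eqP := fh0 g; rewrite mulf_eq0 => /orP[]/eqP;
    [left|right].
  + exact/eqP.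
Qed.

End Regular.

(** * Equality of traces on a normal subgroup of finite index *)

Section Representation.
Variables (F : fieldType) (G : groupType) (n : nat).
Implicit Types rho : gl_repr F G n.

Lemma gl_repr1 rho : rho 1%g = 1%:M.
Proof.
have := gl_reprM rho 1%g 1%g; rewrite mulg1 => E.
by rewrite -[LHS](mulmxK (gl_repr_unit rho 1%g)) -E mulmxV // gl_repr_unit.
Qed.

Lemma gl_reprX rho g k : rho (g ^+ k)%g = rho g ^+ k.
Proof.
elim: k => [|k IHk]; first by rewrite expg0 gl_repr1 expr0.
by rewrite expgS exprS gl_reprM IHk.
Qed.

Lemma power_character_component m rho1 rho2 :
    [pchar F] =i pred0 -> (0 < m)%N ->
    power_character m rho1 =1 power_character m rho2 ->
  exists H : {pred G}, [/\ finite_index_subgroup H,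
    forall x g, x \in H -> (g^-1 * x * g)%g \in H &
    {in H, forall x, \tr (rho1 x) = \tr (rho2 x)}].
Proof.
move=> char0 m0 eq_m.
pose d g := \det (cyclo_mx m (rho1 g) (rho2 g)).
pose t g := \tr (rho1 g) - \tr (rho2 g).
have rd : regular d.
  apply: regular_det; apply: mx_regular_sum => k; apply: mx_regularM.
    exact/(mx_regular_linear lin_mulmx)/mx_regularX/mx_regular_repr.
  exact/(mx_regular_linear (@lin_mulmxr _ _ _ _))/mx_regularX/mx_regular_repr.
have rt : regular t by apply: regularB; apply/regular_trace/mx_regular_repr.
have [||H [fin norm Ht]] := regular_component rd rt.
- move=> g; have [->|dg] := eqVneq (d g) 0; first by rewrite mul0r.
  suff -> : t g = 0 by rewrite mulr0.
  apply/eqP; rewrite subr_eq0; apply/eqP/trace_char_poly/char_poly_cyclo/dg.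
  (* The hypothesis at [g ^+ k.+1] supplies the trace of the power [k.+1] of [rho1 g ^+ m] and of
     [rho2 g ^+ m]. *)
  apply: eq_char_poly_traces char0 _ => k.
  by rewrite -!exprM -!gl_reprX mulnC expgnA; apply: eq_m.
- rewrite /d !gl_repr1 cyclo_mx1 det_scalar expf_neq0 //.
  by rewrite ((pcharf0P F).1 char0) -lt0n.
- by exists H; split=> // x /Ht /eqP; rewrite subr_eq0 => /eqP.
Qed.

End Representation.

(** * Modules over a monoid and their traces *)

(** The dimension is a field, so that modules of different dimensions can be put in one list. *)
Record mrep (F : fieldType) (T : Type) (mul : T -> T -> T) (one : T) := MRep {
  mdim : nat;
  mact :> T -> 'M[F]_mdim;
  mactM : forall x y, mact (mul x y) = mact x *m mact y;
  mact1 : mact one = 1%:M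
}.

(** Classical equality gives lists of modules a membership predicate. *)
HB.instance Definition _ F T mul one := gen_eqMixin (@mrep F T mul one).

Section MonoidModules.
Variables (F : fieldType) (T : Type) (mul : T -> T -> T) (one : T).
Local Notation mrep := (@mrep F T mul one).
Implicit Types (r W U : mrep) (s : seq mrep) (a b : seq (F * T)).

Definition mstable r p (U : 'M[F]_(p, mdim r)) : Prop :=
  forall x, stablemx U (r x).

Definition msimple r : Prop :=
  (0 < mdim r)%N /\ forall U : 'M[F]_(mdim r), mstable U -> U != 0 ->
    row_full U.

Definition mhom r r' (P : 'M[F]_(mdim r, mdim r')) : Prop :=
  forall x, r x *m P = P *m r' x.

Definition miso r r' : Prop :=
  exists (P : 'M[F]_(mdim r, mdim r')) (Q : 'M[F]_(mdim r', mdim r)),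
    [/\ mhom P, P *m Q = 1%:M & Q *m P = 1%:M].

Lemma miso_sym r r' : miso r r' -> miso r' r.
Proof.
move=> [P [Q [homP PQ QP]]]; exists Q, P; split=> // x.
by rewrite -[r' x]mul1mx -QP -(mulmxA Q) -homP -!mulmxA PQ mulmx1.
Qed.

Lemma miso_refl r : miso r r.
Proof. by exists 1%:M, 1%:M; split=> [x||]; rewrite ?mulmx1 ?mul1mx. Qed.

Lemma miso_trans r1 r2 r3 : miso r1 r2 -> miso r2 r3 -> miso r1 r3.
Proof.
move=> [P [Q [homP PQ QP]]] [P' [Q' [homP' PQ' QP']]].
exists (P *m P'), (Q' *m Q); split=> [x||].
- by rewrite mulmxA homP -!mulmxA homP'.
- by rewrite mulmxA -(mulmxA P) PQ' mulmx1.
- by rewrite mulmxA -(mulmxA Q') QP mulmx1.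
Qed.

Lemma miso_trace r r' x : miso r r' -> \tr (r x) = \tr (r' x).
Proof.
move=> [P [Q [homP PQ QP]]].
by rewrite -[r x]mulmx1 -PQ mulmxA homP mxtrace_mulC mulmxA QP mul1mx.
Qed.

Lemma miso_dim0 r r' : mdim r = 0 -> mdim r' = 0 -> miso r r'.
Proof.
move=> r0 r'0; exists 0, 0; split=> [x||]; rewrite ?mulmx0 ?mul0mx //.
  by apply/matrixP => -[i lti]; exfalso; move: lti; rewrite r0.
by apply/matrixP => -[i lti]; exfalso; move: lti; rewrite r'0.
Qed.

(** The kernel and the image are stable, so the former is zero and the latter is everything. *)
Lemma Schur_iso r r' (P : 'M[F]_(mdim r, mdim r')) :
  msimple r -> msimple r' -> mhom P -> P != 0 -> miso r r'.
Proof.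
move=> [_ simr] [_ simr'] homP P0.
have freeP : row_free P.
  rewrite -kermx_eq0; apply/negPn/negP => K0.
  have : row_full (kermx P).
    apply: simr => // x; apply/sub_kermxP.
    by rewrite -mulmxA homP mulmxA mulmx_ker mul0mx.
  rewrite -sub1mx => /sub_kermxP; rewrite mul1mx => PE.
  by rewrite PE eqxx in P0.
have fullP : row_full P.
  have : row_full <<P>>%MS.
    apply: simr'; last by rewrite -mxrank_eq0 genmxE mxrank_eq0.
    by move=> x; rewrite genmxE (eqmxMr _ (genmxE P)) -homP submxMl.
  by rewrite -!sub1mx genmxE.
by exists P, (pinvmx P); rewrite mulmxVp // mulVpmx.
Qed.

(** Lists of weighted elements stand for the monoid algebra. Lists for the same element are not
    identified; they are only compared through their actions. *)
Definition gext r a : 'M[F]_(mdim r) := \sum_(p <- a) p.1 *: r p.2.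
Definition gmul a b := [seq (p.1 * q.1, mul p.2 q.2) | p <- a, q <- b].
Definition gscale (c : F) a := [seq (c * p.1, p.2) | p <- a].

Lemma gext_cat r a b : gext r (a ++ b) = gext r a + gext r b.
Proof. by rewrite /gext big_cat. Qed.

Lemma gext_scale r c a : gext r (gscale c a) = c *: gext r a.
Proof.
by rewrite /gext big_map scaler_sumr; apply: eq_bigr => p _; rewrite scalerA.
Qed.

Lemma gext_mul r a b : gext r (gmul a b) = gext r a *m gext r b.
Proof.
rewrite /gext /gmul big_allpairs_dep mulmx_suml; apply: eq_bigr => p _.
rewrite mulmx_sumr; apply: eq_bigr => q _ /=.
by rewrite mactM -scalemxAl -scalemxAr scalerA.
Qed.

Lemma gext1 r x : gext r [:: (1, x)] = r x.
Proof. by rewrite /gext big_seq1 scale1r. Qed.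

Fixpoint gexp a k := if k is k'.+1 then gmul a (gexp a k') else [:: (1, one)].

Lemma gext_exp r a k : gext r (gexp a k) = gext r a ^+ k.
Proof.
elim: k => [|k IHk] /=; first by rewrite gext1 mact1 expr0.
by rewrite gext_mul IHk exprS.
Qed.

Lemma gext_trace r r' a : (forall x, \tr (r x) = \tr (r' x)) ->
  \tr (gext r a) = \tr (gext r' a).
Proof.
move=> eq_tr; rewrite /gext !raddf_sum; apply: eq_bigr => p _ /=.
by rewrite !mxtraceZ eq_tr.
Qed.

Lemma gext_hom r r' (P : 'M[F]_(mdim r, mdim r')) a :
  mhom P -> gext r a *m P = P *m gext r' a.
Proof.
move=> homP; rewrite mulmx_suml mulmx_sumr; apply: eq_bigr => p _.
by rewrite -scalemxAl -scalemxAr homP.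
Qed.

Lemma gext_expr_hom r r' (P : 'M[F]_(mdim r, mdim r')) a k :
  mhom P -> gext r a ^+ k *m P = P *m gext r' a ^+ k.
Proof. by move=> homP; rewrite -!gext_exp; apply: gext_hom. Qed.

Definition right_ideal (J : seq (F * T) -> Prop) : Prop :=
  [/\ J [::], forall c a b, J a -> J b -> J (gscale c a ++ b)
    & forall a b, J a -> J (gmul a b)].

(** The vectors [w *m gext r a] with [a] in [J] form a nonzero submodule of a simple module. *)
Lemma right_ideal_orbit (J : seq (F * T) -> Prop) r (w : 'rV_(mdim r)) :
    right_ideal J -> msimple r -> (exists2 a, J a & w *m gext r a != 0) ->
  forall u, exists2 a, J a & u = w *m gext r a.
Proof.
move=> [J0 Jlin Jmul] [_ simr] [a Ja wa0].
have [|c u1 u2 [b1 b10 ->] [b2 b20 ->]|X XP] :=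
    @subspace_mx F _ (fun u => exists2 b, J b & u = w *m gext r b).
- by exists [::]; rewrite // /gext big_nil ?mulmx0.
- exists (gscale c b1 ++ b2); first exact: Jlin.
  by rewrite gext_cat gext_scale mulmxDr scalemxAr.
have fullX : row_full X.
  apply: simr.
    move=> x; apply/rV_subP => _ /submxP[D ->]; rewrite mulmxA; apply/XP.
    have /XP[b b0 ->] : (D *m X <= X)%MS by apply: submxMl.
    exists (gmul b [:: (1, x)]); first exact: Jmul.
    by rewrite gext_mul gext1 mulmxA.
  apply: contraNneq wa0 => X0.
  have /XP : exists2 b, J b & w *m gext r a = w *m gext r b by exists a.
  by rewrite X0 submx0.
by move=> u; apply/XP; apply: submx_full.
Qed.

(* The a that kill r2 form a two-sided ideal acting on r1 by nilpotent
   operators; such an ideal kills every simple submodule W of r1, since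
   otherwise w *m a = w for some nonzero w in W and some a in the ideal. *)
Lemma annihilator_simple r1 r2 W (E : 'M[F]_(mdim W, mdim r1)) a :
    [pchar F] =i pred0 -> (forall x, \tr (r1 x) = \tr (r2 x)) ->
    msimple W -> mhom E -> row_free E ->
  gext r2 a = 0 -> gext W a = 0.
Proof.
move=> char0 eq_tr simW homE freeE a0.
have nilp b : gext r2 b = 0 -> gext W b ^+ mdim r1 = 0.
  move=> b0; apply: (row_free_inj freeE); rewrite gext_expr_hom // mul0mx.
  rewrite nilpotent_traces ?mulmx0 // => k.
  by rewrite -gext_exp (gext_trace _ eq_tr) gext_exp b0 expr0n mxtrace0.
apply/row_matrixP => i; rewrite row0 rowE; set w := delta_mx 0 i.
apply/eqP/negPn/negP => wa0.
have idJ : right_ideal (fun b => gext r2 b = 0).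
  split=> [|c b1 b2 b10 b20|b1 b2 b10]; first by rewrite /gext big_nil.
    by rewrite gext_cat gext_scale b10 b20 scaler0 addr0.
  by rewrite gext_mul b10 mul0mx.
have [b b0 wb] := right_ideal_orbit idJ simW (ex_intro2 _ _ a a0 wa0) w.
have wbk k : w *m gext W b ^+ k = w.
  elim: k => [|k IHk]; first by rewrite expr0 mulmx1.
  by rewrite exprS -mulmxE mulmxA -wb.
case/negP: wa0; rewrite -[w](wbk (mdim r1)) nilp // mulmx0 mul0mx //.
Qed.

(* Otherwise u *m a |-> w *m a would be a well-defined isomorphism U -> W. *)
Lemma right_ideal_separate (J : seq (F * T) -> Prop) W U
    (w : 'rV_(mdim W)) (u : 'rV_(mdim U)) :
    right_ideal J -> msimple W -> msimple U -> ~ miso U W ->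
    (exists2 a, J a & w *m gext W a != 0) ->
  exists2 a, J a /\ u *m gext U a = 0 & w *m gext W a != 0.
Proof.
move=> idJ simW simU not_iso Jw; apply: contrapT => no.
have wd a : J a -> u *m gext U a = 0 -> w *m gext W a = 0.
  move=> Ja ua; apply: contrapT => /eqP wa; apply: no.
  by exists a.
have Ju : exists2 a, J a & u *m gext U a != 0.
  have [a Ja wa] := Jw; exists a => //; apply/eqP => /(wd a Ja) wa0.
  by rewrite wa0 eqxx in wa.
have orbU := right_ideal_orbit idJ simU Ju.
case: (idJ) => J0 Jlin Jmul.
have [|c y1 y2 [b1 b10 ->] [b2 b20 ->]|Y YP] :=
    @subspace_mx F (mdim U + mdim W)
      (fun y => exists2 b, J b & y = row_mx (u *m gext U b) (w *m gext W b)).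
- by exists [::]; rewrite // /gext !big_nil !mulmx0 row_mx0.
- exists (gscale c b1 ++ b2); first exact: Jlin.
  by rewrite !gext_cat !gext_scale scale_row_mx add_row_mx !mulmxDr !scalemxAr.
(* The row space of [Y] is the graph of the map in question, and [P] is its matrix. *)
pose P := pinvmx (lsubmx Y) *m rsubmx Y.
have mulY (D : 'rV_(mdim U + mdim W)) : D *m Y = row_mx (D *m lsubmx Y) (D *m
  rsubmx Y).
  by rewrite -mul_mx_row hsubmxK.
have PE b : J b -> u *m gext U b *m P = w *m gext W b.
  move=> Jb; have /YP/submxP[D defD] : exists2 b', J b' &
      row_mx (u *m gext U b) (w *m gext W b) = row_mx (u *m gext U b') (w *m
        gext W b').
    by exists b.
  have subU : (u *m gext U b <= lsubmx Y)%MS.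
    by rewrite -[X in (X <= _)%MS](row_mxKl _ (w *m gext W b)) defD -mulmx_lsub
      submxMl.
  have : (u *m gext U b *m pinvmx (lsubmx Y) *m Y <= Y)%MS by apply: submxMl.
  case/YP=> b' Jb'; rewrite mulY mulmxKpV // -mulmxA.
  case/eq_row_mx=> eqU ->; apply/eqP; rewrite -subr_eq0; apply/eqP.
  have := wd (gscale (-1) b ++ b'); rewrite !gext_cat !gext_scale !scaleN1r.
  rewrite !mulmxDr !mulmxN -eqU addNr (addrC (- (w *m gext W b))).
  by apply=> //; apply: Jlin.
move: P PE => P PE; apply: not_iso; apply: (@Schur_iso _ _ P) => //; last first.
  have [a Ja wa] := Jw; apply: contraNneq wa => P0.
  by rewrite -PE // P0 mulmx0.
move=> x; apply/row_matrixP => i; rewrite !rowE; set e := delta_mx 0 i.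
have [b Jb ->] := orbU e; rewrite !mulmxA PE //.
rewrite -[u *m _ *m U x]mulmxA -[w *m _ *m W x]mulmxA -(gext1 U) -(gext1 W)
  -!gext_mul.
by rewrite PE //; apply: Jmul.
Qed.

(** Kill the basis vectors of [U] one at a time, replacing [J] by the right ideal of its elements
    that kill the earlier ones. *)
Lemma right_ideal_separate_all (J : seq (F * T) -> Prop) W U
    (w : 'rV_(mdim W)) :
    right_ideal J -> msimple W -> msimple U -> ~ miso U W ->
    (exists2 a, J a & w *m gext W a != 0) ->
  exists2 a, J a /\ gext U a = 0 & w *m gext W a != 0.
Proof.
move=> idJ simW simU not_iso Jw.
suff /(_ (mdim U))[a [Ja ka] wa] : forall k, exists2 a, J a /\
    (forall i : 'I_(mdim U), (i < k)%N ->
      delta_mx 0 i *m gext U a = 0 :> 'rV_(mdim U))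
    & w *m gext W a != 0.
  by exists a => //; split=> //; apply/row_matrixP => i; rewrite rowE row0 ka.
elim=> [|k [a0 [Ja0 ka0] wa0]].
  by have [a Ja wa] := Jw; exists a.
have [lt_k|le_k] := ltnP k (mdim U); last first.
  by exists a0 => //; split=> // i _; apply/ka0/(leq_trans (ltn_ord i)).
pose J' a := J a /\ forall i : 'I_(mdim U), (i < k)%N ->
  delta_mx 0 i *m gext U a = 0 :> 'rV_(mdim U).
have idJ' : right_ideal J'.
  case: idJ => J0 Jlin Jmul; split.
  - by split=> // i _; rewrite /gext big_nil mulmx0.
  - move=> c a b [Ja ka] [Jb kb]; split; first exact: Jlin.
    move=> i ik; rewrite gext_cat gext_scale mulmxDr -scalemxAr ka // kb //.
    by rewrite scaler0 addr0.
  - move=> a b [Ja ka]; split; first exact: Jmul.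
    by move=> i ik; rewrite gext_mul mulmxA ka // mul0mx.
have J'w : exists2 a, J' a & w *m gext W a != 0 by exists a0.
have [a [[Ja ka] ea] wa] :=
  right_ideal_separate (delta_mx 0 (Ordinal lt_k)) idJ' simW simU not_iso J'w.
exists a => //; split=> // i; rewrite ltnS leq_eqVlt => /orP[/eqP ik|];
  last exact: ka.
by rewrite -ea; congr (delta_mx 0 _ *m _); apply: val_inj.
Qed.


Lemma annihilator_right_ideal s :
  right_ideal (fun a => forall r, r \in s -> gext r a = 0).
Proof.
split=> [r _|c a b a0 b0 r rs|a b a0 r rs]; first by rewrite /gext big_nil.
  by rewrite gext_cat gext_scale a0 // b0 // scaler0 addr0.
by rewrite gext_mul a0 // mul0mx.
Qed.

(** Induction on [s]: the annihilator of the modules already treated is a right ideal in which the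
    next module can be separated from [W]. *)
Lemma annihilator_separate s W (w : 'rV_(mdim W)) :
    msimple W -> w != 0 ->
    (forall U, U \in s -> msimple U /\ ~ miso U W) ->
  exists2 a, forall r, r \in s -> gext r a = 0 & w *m gext W a != 0.
Proof.
move=> simW w0; elim: s => [|U s IHs] sP.
  by exists [:: (1, one)] => //; rewrite gext1 mact1 mulmx1.
have [|a as0 wa] := IHs; first by move=> r rs; apply: sP;
  rewrite in_cons rs orbT.
have [simU nisoU] := sP U (mem_head _ _).
have [b [bs0 bU0] wb] := @right_ideal_separate_all _ W U w
  (annihilator_right_ideal s) simW simU nisoU (ex_intro2 _ _ a as0 wa).
by exists b => // r; rewrite in_cons => /orP[/eqP->|/bs0].
Qed.

(** * Direct sums and their traces *)

Fact mrep0_subproof (x y : T) : 0 = (0 : 'M[F]_0) *m (0 : 'M[F]_0).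
Proof. by rewrite mulmx0. Qed.
Fact mrep0_subproof1 : 0 = 1%:M :> 'M[F]_0.
Proof. by rewrite [RHS]flatmx0. Qed.
Definition mrep0 : mrep :=
  @MRep F T mul one 0 (fun=> 0) mrep0_subproof mrep0_subproof1.

Fact mrepD_subproof r r' x y :
  block_mx (r (mul x y)) 0 0 (r' (mul x y)) =
  block_mx (r x) 0 0 (r' x) *m block_mx (r y) 0 0 (r' y).
Proof. by rewrite mulmx_block !mulmx0 !mul0mx !addr0 !add0r !mactM. Qed.
Fact mrepD_subproof1 r r' : block_mx (r one) 0 0 (r' one) = 1%:M.
Proof. by rewrite !mact1 -scalar_mx_block. Qed.
Definition mrepD r r' : mrep :=
  @MRep F T mul one (mdim r + mdim r') (fun x => block_mx (r x) 0 0 (r' x))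
    (mrepD_subproof r r') (mrepD_subproof1 r r').

Definition dsum s : mrep := foldr mrepD mrep0 s.

Lemma mrepD_iso r1 r2 r1' r2' : miso r1 r1' -> miso r2 r2' ->
  miso (mrepD r1 r2) (mrepD r1' r2').
Proof.
move=> [P [Q [homP PQ QP]]] [P' [Q' [homP' PQ' QP']]].
exists (block_mx P 0 0 P'), (block_mx Q 0 0 Q'); split=> [x||];
  rewrite /= !mulmx_block !mulmx0 !mul0mx !addr0 !add0r.
- by rewrite homP homP'.
- by rewrite PQ PQ' -scalar_mx_block.
- by rewrite QP QP' -scalar_mx_block.
Qed.

Lemma mrepDC_iso r1 r2 r3 : miso (mrepD r1 (mrepD r2 r3)) (mrepD r2 (mrepD r1
  r3)).
Proof.
exists (block_mx 0 (row_mx 1%:M 0) (col_mx 1%:M 0) (block_mx 0 0 0 1%:M)).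
exists (block_mx 0 (row_mx 1%:M 0) (col_mx 1%:M 0) (block_mx 0 0 0 1%:M)).
split=> [x||]; rewrite /= !mulmx_block ?mulmx0 ?mul0mx ?addr0 ?add0r.
all: rewrite ?mul_mx_row ?mul_col_mx ?mul_row_block ?mul_block_col ?mulmx_block.
all: rewrite ?mul_row_col ?mul_col_row ?mulmx0 ?mul0mx ?mulmx1 ?mul1mx ?addr0
  ?add0r //.
all: rewrite ?add_block_mx ?addr0 ?add0r ?row_mx0 ?col_mx0 -?scalar_mx_block //.
all: by rewrite -[X in row_mx _ X]col_mx0 -block_mxEh add_block_mx !addr0
  !add0r -!scalar_mx_block.
Qed.

Lemma dsum_split l U s : miso (dsum (l ++ U :: s)) (dsum (U :: l ++ s)).
Proof.
elim: l => [|V l IHl]; first exact: miso_refl.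
apply: miso_trans (mrepDC_iso V U (dsum (l ++ s))).
exact: mrepD_iso (miso_refl V) IHl.
Qed.

Lemma dsum_cons_trace U s x : \tr (dsum (U :: s) x) = \tr (U x) + \tr (dsum s
  x).
Proof. exact: mxtrace_block. Qed.

Lemma dsum_ann s a : (forall r, r \in s -> gext r a = 0) -> gext (dsum s) a = 0.
Proof.
elim: s => [|U s IHs] a0; first by rewrite [LHS]flatmx0 [RHS]flatmx0.
have -> : gext (dsum (U :: s)) a = block_mx (gext U a) 0 0 (gext (dsum s) a).
  rewrite /gext; elim/big_rec3: _ => [|p M1 M2 M3 _ ->];
    first by rewrite block_mx0.
  by rewrite scale_block_mx add_block_mx !scaler0 !addr0.
rewrite a0 ?mem_head // IHs ?block_mx0 // => r rs.
by apply: a0; rewrite in_cons rs orbT.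
Qed.

(** Cancel one simple summand [W] at a time. If no member of [s2] were isomorphic to [W], some [a]
    would kill all of [s2] but not [W], against [annihilator_simple]. *)
Lemma dsum_iso s1 s2 : [pchar F] =i pred0 ->
    (forall U, U \in s1 -> msimple U) -> (forall U, U \in s2 -> msimple U) ->
    (forall x, \tr (dsum s1 x) = \tr (dsum s2 x)) ->
  miso (dsum s1) (dsum s2).
Proof.
move=> char0; elim: s1 s2 => [|W s1 IHs] s2 sim1 sim2 eq_tr.
  (* The trace at [one] is the dimension, here 0 in [F]. *)
  apply: miso_dim0 => //; apply: (natr_inj_char0 char0) => /=.
  by have := eq_tr one; rewrite !mact1 !mxtrace1 => <-.
have simW := sim1 W (mem_head _ _).
have [U Us isoU] : exists2 U, U \in s2 & miso W U.
  apply: contrapT => noU; have [dW _] := simW.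
  pose w : 'rV[F]_(mdim W) := delta_mx 0 (Ordinal dW).
  have w0 : w != 0 by apply/eqP => /matrixP/(_ 0 (Ordinal dW))/eqP;
    rewrite !mxE !eqxx oner_eq0.
  have [|a as0 wa] := @annihilator_separate s2 W w simW w0.
    by move=> U Us; split; [apply: sim2 | move/miso_sym=> iso; apply: noU;
      exists U].
  pose E : 'M[F]_(mdim W, mdim (dsum (W :: s1))) := row_mx 1%:M 0.
  have homE : mhom (E : 'M_(mdim W, mdim (dsum (W :: s1)))).
    by move=> x; rewrite /E /= mul_row_block mul_mx_row !mulmx1 !mulmx0 !mul1mx
      mul0mx !addr0.
  have freeE : row_free E.
    by apply/row_freeP; exists (col_mx 1%:M 0);
      rewrite mul_row_col mulmx1 mulmx0 addr0.
  have := annihilator_simple char0 eq_tr simW homE freeE (dsum_ann as0).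
  by move=> Wa; rewrite Wa mulmx0 eqxx in wa.
have [l [s def_s2]] : exists l s, s2 = l ++ U :: s.
  by case/splitPr: Us => l s; exists l, s.
rewrite {}def_s2 {Us} in sim2 eq_tr *.
apply: miso_trans (miso_sym (dsum_split l U s)); apply: mrepD_iso => //.
apply: IHs => [V Vs|V|x].
- by apply: sim1; rewrite in_cons Vs orbT.
- rewrite mem_cat => Vs; apply: sim2; rewrite mem_cat in_cons.
  by case/orP: Vs => ->; rewrite ?orbT.
apply: (addrI (\tr (W x))); rewrite -dsum_cons_trace eq_tr.
by rewrite (miso_trace x (dsum_split l U s)) dsum_cons_trace (miso_trace x
  isoU).
Qed.

(** * Simple submodules and decomposition into a direct sum *)

Definition msub_simple r (S : 'M[F]_(mdim r)) : Prop :=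
  [/\ mstable S, S != 0
    & forall V : 'M[F]_(mdim r), mstable V -> (V <= S)%MS -> V != 0 ->
      (S <= V)%MS].

(** The action is written in the coordinates of a row basis [E] of [S], which [pinvmx E] reads
    off. *)
Lemma subrep r (S : 'M[F]_(mdim r)) : msub_simple S ->
  exists2 W, msimple W & exists (E : 'M[F]_(mdim W, mdim r)),
    [/\ mhom E, row_free E & (E :=: S)%MS].
Proof.
move=> [stabS S0 minS]; pose E := row_base S.
have ES : (E :=: S)%MS := eq_row_base S.
have freeE : row_free E by apply: row_base_free.
have stabE x : (E *m r x <= E)%MS by rewrite (eqmxMr _ ES) ES stabS.
pose act x := E *m r x *m pinvmx E.
have actE x : act x *m E = E *m r x by rewrite /act mulmxKpV.
have actM x y : act (mul x y) = act x *m act y.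
  by apply: (row_free_inj freeE);
    rewrite -mulmxA !actE mulmxA actE -mulmxA mactM.
have act1 : act one = 1%:M.
  by apply: (row_free_inj freeE); rewrite actE mact1 mulmx1 mul1mx.
exists (MRep actM act1); last by exists E.
split=> /= [|V stabV V0]; first by rewrite lt0n mxrank_eq0.
have VE0 : V *m E != 0 by rewrite mulmx_free_eq0.
have : (S <= <<V *m E>>)%MS.
  apply: minS; rewrite ?genmxE.
  - by move=> x; rewrite genmxE (eqmxMr _ (genmxE _)) -mulmxA -actE mulmxA
    submxMr.
  - by rewrite -ES submxMl.
  - by rewrite -mxrank_eq0 genmxE mxrank_eq0.
rewrite genmxE => /mxrankS; rewrite mxrankMfree // => le_rk.
by rewrite /row_full eqn_leq rank_leq_col.
Qed.

(** Extend an embedded sum of simple modules as long as it is not everything: a simple submodule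
    outside the image meets it in 0, so the enlarged sum is still embedded. *)
Lemma semisimple_dsum r :
    (forall U : 'M[F]_(mdim r), mstable U -> ~~ row_full U ->
      exists2 S : 'M[F]_(mdim r), msub_simple S & ~~ (S <= U)%MS) ->
  exists2 s, forall U, U \in s -> msimple U & miso r (dsum s).
Proof.
move=> ssr.
suff ext k s (E : 'M[F]_(mdim (dsum s), mdim r)) :
    (forall U, U \in s -> msimple U) -> mhom E -> row_free E ->
    (mdim r - mdim (dsum s) < k)%N ->
    exists2 s, forall U, U \in s -> msimple U & miso r (dsum s).
  apply: (ext _ [::] 0 _ _ _ (ltnSn _)) => //; first by move=> x;
    rewrite mulmx0 mul0mx.
  by rewrite /row_free mxrank0.
elim: k s E => // k IHk s E sims homE freeE lt_k.
have [fullE|nfullE] := boolP (row_full E).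
  exists s => //; apply: miso_sym; exists E, (pinvmx E).
  by rewrite mulmxVp // mulVpmx.
have stabE x : (E *m r x <= E)%MS by rewrite -homE submxMl.
have [||S simS SE] := ssr <<E>>%MS.
- by move=> x; rewrite genmxE (eqmxMr _ (genmxE _)) stabE.
- by rewrite -sub1mx genmxE sub1mx.
rewrite genmxE in SE.
have [W simW [E' [homE' freeE' E'S]]] := subrep simS.
have SE0 : (S :&: E)%MS = 0.
  apply/eqP/negPn/negP => SE0; case/negP: SE; apply: submx_trans (capmxSr S E).
  case: simS => stabS S0; apply=> //; last exact: capmxSl.
  move=> x; rewrite sub_capmx.
  rewrite (submx_trans (submxMr _ (capmxSl _ _)) (stabS x)).
  by rewrite (submx_trans (submxMr _ (capmxSr _ _)) (stabE x)).
have rkE' : \rank E' = mdim W by apply/eqP.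
have rkE : \rank E = mdim (dsum s) by apply/eqP.
have freeN : row_free (col_mx E' E).
  rewrite /row_free -addsmxE (adds_eqmx E'S (eqmx_refl E)) mxrank_disjoint_sum
    //.
  by rewrite -E'S rkE' rkE.
apply: (IHk (W :: s) (col_mx E' E)) => //.
- by move=> U; rewrite in_cons => /orP[/eqP->|/sims].
- by move=> x; rewrite /= mul_block_col !mul0mx addr0 add0r homE' homE
  mul_col_mx.
- case: simW => dW _; have := rank_leq_col (col_mx E' E).
  rewrite (eqP freeN) /=; lia.
Qed.

End MonoidModules.

(** * Restriction to a normal subgroup *)

Section Restriction.
Variables (F : fieldType) (G : groupType) (n : nat).
Variables (H : {pred G}) (grpH : group_closed H).
Implicit Types rho : gl_repr F G n.

Definition submul (x y : {x | x \in H}) : {x | x \in H} :=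
  exist _ (sval x * sval y)%g (group_closedM grpH (svalP x) (svalP y)).
Definition subone : {x | x \in H} := exist _ 1%g grpH.1.

Definition restriction rho : mrep F submul subone :=
  @MRep F _ submul subone n (fun x => rho (sval x))
    (fun x y => gl_reprM rho (sval x) (sval y)) (gl_repr1 rho).

Hypothesis normH : forall x g, x \in H -> (g^-1 * x * g)%g \in H.

Lemma min_stable (r : mrep F submul subone) (U : 'M[F]_(mdim r)) :
  mstable U -> U != 0 -> exists2 S : 'M[F]_(mdim r),
    msub_simple S & (S <= U)%MS.
Proof.
have [k] := ubnP (\rank U); elim: k U => // k IHk U ltk stabU U0.
have [minU|] := pselect (msub_simple U); first by exists U.
move=> notmin.
have [V [stabV VU V0 UV]] : exists V : 'M[F]_(mdim r),
    [/\ mstable V, (V <= U)%MS, V != 0 & ~ (U <= V)%MS].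
  apply: contrapT => noV; apply: notmin; split=> // V stabV VU V0.
  by apply: contrapT => UV; apply: noV; exists V.
have ltV : (\rank V < k)%N.
  apply: leq_trans (_ : \rank U <= k)%N => //; apply: rank_ltmx.
  by rewrite ltmxE VU; apply/negP.
have [S simS SV] := IHk V ltV stabV V0.
by exists S => //; apply: submx_trans SV VU.
Qed.

(** By normality, [rho h] carries stable subspaces to stable subspaces, since [x] acts on the
    translate as [h * x * h^-1] acts on the original. *)
Lemma msub_simple_translate rho (S : 'M[F]_n) g :
  msub_simple (r := restriction rho) S ->
  msub_simple (r := restriction rho) (S *m rho g).
Proof.
have uR := gl_repr_unit rho.
have stabJ (V : 'M[F]_n) h : mstable (r := restriction rho) V ->
    mstable (r := restriction rho) (V *m rho h).
  move=> stabV [x xH] /=.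
  have -> : V *m rho h *m rho x = V *m rho (h * x * h^-1)%g *m rho h.
    by rewrite -!mulmxA -!gl_reprM -!mulgA mulVg mulg1.
  apply: submxMr.
  have xJ : (h * x * h^-1)%g \in H by have := normH h^-1%g xH; rewrite invgK.
  exact: (stabV (exist (fun y => y \in H) _ xJ)).
move=> [stabS S0 minS]; split; first exact: stabJ.
  apply: contraNneq S0 => SR0.
  by rewrite -[S](mulmxK (uR g)) SR0 mul0mx.
move=> V stabV VS V0.
have rhoV : rho g *m rho g^-1%g = 1%:M by rewrite -gl_reprM mulgV gl_repr1.
have rhoV' : rho g^-1%g *m rho g = 1%:M by rewrite -gl_reprM mulVg gl_repr1.
have : (S <= V *m rho g^-1%g)%MS.
  apply: minS; first exact: stabJ.
    by rewrite -[S]mulmx1 -rhoV mulmxA submxMr.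
  by apply: contraNneq V0 => V0'; rewrite -[V]mulmx1 -rhoV' mulmxA V0' mul0mx.
by move/(submxMr (rho g)); rewrite -mulmxA rhoV' mulmx1.
Qed.

(** Given a proper stable [V], choose an irreducible [U i] outside [V] and a simple [S] for [H]
    inside [U i]. Some translate of [S] under [G] must leave [V]. *)
Lemma Clifford_semisimple rho : semisimple_repr rho ->
  exists2 s, forall U, U \in s -> msimple U & miso (restriction rho) (dsum s).
Proof.
move=> [k [U [irrU sumU _]]]; apply: semisimple_dsum => /= V stabV nfullV.
have [i UiV] : exists i, ~~ (U i <= V)%MS.
  apply: contrapT => noi; case/negP: nfullV; rewrite -sub1mx -sumU.
  by apply/sumsmx_subP => i _; apply: contrapT => /negP UiV; apply: noi;
    exists i.
have [invU U0 minU] := irrU i.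
have stabU : mstable (r := restriction rho) (U i) by move=> [x xH]; apply: invU.
have [S simS SU] := min_stable stabU U0.
have [inV|/existsNP[g /negP SgV]] :=
    pselect (forall g, (S *m rho g <= V)%MS); last first.
  by exists (S *m rho g) => //; apply: msub_simple_translate.
case/negP: UiV.
(* [X] is the largest [G]-stable subspace of [U i :&: V]. It contains [S] if all translates of [S]
   lie in [V], and then irreducibility forces [U i] into [V]. *)
have [|c u w uP wP g|X XP] :=
    @subspace_mx F n (fun u => forall g, (u *m rho g <= U i :&: V)%MS).
- by move=> g; rewrite mul0mx sub0mx.
- by rewrite mulmxDl -scalemxAl addmx_sub ?scalemx_sub.
have subX : (X <= U i :&: V)%MS.
  apply/rV_subP => u /XP/(_ 1%g); by rewrite gl_repr1 mulmx1.
apply: submx_trans (submx_trans subX (capmxSr _ _)).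
apply: minU.
- move=> g; apply/rV_subP => _ /submxP[D ->]; apply/XP => h.
  rewrite mulmxA -mulmxA -gl_reprM.
  by have /XP : (D *m X <= X)%MS by apply: submxMl.
- exact: submx_trans subX (capmxSl _ _).
case: simS => _ S0 _; apply: contraNneq S0 => X0.
suff : (S <= X)%MS by rewrite X0 submx0.
apply/rV_subP => u uS; apply/XP => g; rewrite sub_capmx.
rewrite (submx_trans (submxMr (rho g) (submx_trans uS SU)) (invU g)).
exact: submx_trans (submxMr (rho g) uS) (inV g).
Qed.

End Restriction.

(** * The three implications *)

Section Equivalences.
Variables (F : fieldType) (G : groupType) (n : nat).
Implicit Types rho : gl_repr F G n.

(** Two of the powers of [g] with exponents from 0 to [size s] lie in the same coset. *)
Lemma finite_index_exp (H : {pred G}) g : finite_index_subgroup H ->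
  exists2 m, (0 < m)%N & (g ^+ m)%g \in H.
Proof.
move=> [grpH [s sP]].
have /choice[c cP] (i : 'I_(size s).+1) :
    exists k : 'I_(size s), ((nth 1%g s k)^-1 * g ^+ i)%g \in H.
  have [a as_ aH] := sP (g ^+ i)%g;
    have lt_a : (index a s < size s)%N by rewrite index_mem.
  by exists (Ordinal lt_a); rewrite /= nth_index.
have /injectivePn[i [j neq_ij eq_ij]] : ~~ injectiveb c.
  apply/negP => /injectiveP inj_c.
  by have := leq_card _ inj_c; rewrite !card_ord ltnn.
wlog lt_ij : i j neq_ij eq_ij / (i < j)%N.
  move=> IH; have [|lt_ji|/val_inj eq_ij'] := ltngtP i j; first exact: IH.
    by apply: (IH j i) => //; rewrite eq_sym.
  by rewrite eq_ij' eqxx in neq_ij.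
exists (j - i)%N; first by rewrite subn_gt0.
have := group_closedM grpH (group_closedV grpH (cP i)) (cP j).
rewrite eq_ij invgM invgK -mulgA mulVKg.
by rewrite -[X in (_ * g ^+ X)%g](subnKC (ltnW lt_ij)) expgnDr mulKg.
Qed.

Lemma potential_elementwise rho1 rho2 :
  potentially_equivalent rho1 rho2 ->
    elementwise_potentially_equivalent rho1 rho2.
Proof.
move=> [H finH [B uB isoB]] g; have [m m0 gmH] := finite_index_exp g finH.
exists m => //; exists B => //.
by rewrite -!gl_reprX isoB // mulmxK.
Qed.

Lemma elementwise_power m rho1 rho2 : bounded_torsion F (n * n) m ->
  elementwise_potentially_equivalent rho1 rho2 ->
  power_character m rho1 =1 power_character m rho2.
Proof.
move=> tors equiv g; have [k k0 [P uP eqP]] := equiv g.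
rewrite /power_character !gl_reprX.
apply: (trace_exp_potential tors k0 (gl_repr_unit rho2 g)).
by rewrite eqP char_poly_conj.
Qed.

Lemma power_potential m rho1 rho2 : [pchar F] =i pred0 -> (0 < m)%N ->
    semisimple_repr rho1 -> semisimple_repr rho2 ->
    power_character m rho1 =1 power_character m rho2 ->
  potentially_equivalent rho1 rho2.
Proof.
move=> char0 m0 ss1 ss2 eq_m.
have [H [finH normH eq_tr]] := power_character_component char0 m0 eq_m.
exists H => //; have [grpH _] := finH.
have [s1 sim1 iso1] := Clifford_semisimple grpH normH ss1.
have [s2 sim2 iso2] := Clifford_semisimple grpH normH ss2.
(* The order is reversed because [isomorphic_on] asks for [B *m rho1 h = rho2 h *m B], which in the
   row convention is a map from [rho2] to [rho1]. *)
have iso12 : miso (dsum s2) (dsum s1).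
  apply: dsum_iso => // x; rewrite -(miso_trace x iso1) -(miso_trace x iso2).
  by rewrite /= eq_tr //; exact: (svalP x).
have [P [Q [homP PQ _]]] := miso_trans iso2 (miso_trans iso12 (miso_sym iso1)).
exists P; first by have [] := mulmx1_unit PQ.
by move=> h hH; have := homP (exist _ h hH).
Qed.

End Equivalences.

Local Close Scope ring_scope.

Theorem theorem2p4 (F : fieldType) (n : nat)
    (localF : nonarch_local_field F) (char0F : [pchar F]%R =i pred0) :
  exists2 m : nat, 1 <= m &
    forall (G : groupType) (rho1 rho2 : gl_repr F G n),
      semisimple_repr rho1 -> semisimple_repr rho2 ->
      [<-> potentially_equivalent rho1 rho2;
           elementwise_potentially_equivalent rho1 rho2;
           power_character m rho1 =1 power_character m rho2].
Proof.
(* Ratios of eigenvalues have degree at most [n * n] over [F]; [m] is fixed before the group and the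
   representations. *)
have [m m0 tors] := local_field_bounded_torsion (n * n) localF char0F.
exists m => // G rho1 rho2 ss1 ss2; tfae.
- exact: potential_elementwise.
- exact: elementwise_power.
- exact: power_potential.
Qed.
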